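(* Let $G=\mathbb{R}_+$ or $G=\mathbb{R}$, $r\in\mathbb{N}$, $k\in(0,r)\setminus\mathbb{N}$, and let $E$ be an ideal semi shift-invariant lattice on $G$, with associated space $E^1$, such that $$(\cdot)^{r-k-1}\chi_{(0,1)}(\cdot)\in E^1\quad\text{and}\quad\lim_{h\to0^+}\left\|(\cdot)^{r-1-k}\chi_{(0,h)}(\cdot)\right\|_{E^1}=0.$$ Let $\Omega\in V(G)$ be such that $\mathcal{R}_{r-k}-\Omega^{[r-1]}\in E^1$ and, for every $f\in L^r_{\infty,E}(G)$, $$D^k_-f(0)-\int_G f(x)\,d\Omega(x)=(-1)^r\int_G\left(\mathcal{R}_{r-k}(x)-\Omega^{[r-1]}(x)\right)f^{(r)}(x)\,dx.$$ Then for every $f\in L^r_{\infty,E}(G)$, $$\left\|D^k_-f\right\|_{L_\infty(G)}\leqslant\bigvee_G\Omega\cdot\|f\|_{L_\infty(G)}+\left\|\mathcal{R}_{r-k}-\Omega^{[r-1]}\right\|_{E^1}\cdot\left\|f^{(r)}\right\|_E.\qquad( * )$$ Furthermore, if a function $\Phi\in W^r_{\infty,E}(G)$ satisfies $$\int_G\Phi(t)\,d\Omega(t)=\bigvee_G\Omega\cdot\|\Phi\|_{L_\infty(G)}$$ and $$(-1)^r\int_G\left(\mathcal{R}_{r-k}(x)-\Omega^{[r-1]}(x)\right)\Phi^{(r)}(x)\,dx=\left\|\mathcal{R}_{r-k}-\Omega^{[r-1]}\right\|_{E^1},$$ then inequality $( * )$ is sharp and $\Phi$ turns $( * )$ into 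equality.
   Context: $\mathbb{R}_+=[0,+\infty)$; $\chi_B$ is the indicator function of $B$. An ideal lattice on $G$ is a linear space $E$ of measurable functions $G\to\mathbb{R}$ with a norm $\|\cdot\|_E$ such that if $f\in E$, $g$ is measurable and $|g|\leqslant|f|$ a.e. on $G$, then $g\in E$ and $\|g\|_E\leqslant\|f\|_E$. It is semi shift-invariant if for every $f\in E$ and $x\in G$ we have $f(\cdot+x)\in E$ and $\|f(\cdot+x)\|_E=\|f\|_E$ if $G=\mathbb{R}$, respectively $\|f(\cdot+x)\|_E\leqslant\|f\|_E$ if $G=\mathbb{R}_+$. The support $A(E)\subset G$ of $E$ is the set such that $f(x)=0$ for every $f\in E$, $x\notin A(E)$. The associated space $E^1$ consists of measurable $g$ with $\mathrm{supp}\,g\subset A(E)$ and $\|g\|_{E^1}:=\sup\{\int_G f(x)g(x)\,dx: f\in E,\ \|f\|_E\leqslant1\}<\infty$. $L^r_{\infty,E}(G)$ is the space of $f\in L_\infty(G)$ such that $f^{(r-1)}$ is locally absolutely continuous on $G$ and $f^{(r)}\in E$; $W^r_{\infty,E}(G)=\{f\in L^r_{\infty,E}(G):\|f^{(r)}\|_E\leqslant1\}$. Marchaud derivative: for $k>0$, $k\notin\mathbb{N}$, $f:G\to\mathbb{R}$, $x\in G$, $D^k_-f(x)=\frac{1}{\varkappa(k,n)}\int_0^{+\infty}\frac{(\Delta^n_{-t}f)(x)}{t^{1+k}}\,dt$, where $n\in\mathbb{N}$, $n>k$ (the definition does not depend on $n$), $(\Delta^n_{-t}f)(x)=\sum_{m=0}^n(-1)^m\binom{n}{m}f(x+mt)$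 and $\varkappa(k,n)=\Gamma(-k)\sum_{m=0}^n(-1)^m\binom{n}{m}m^k$. $V(G)$ is the space of functions in $L_1(G)$ of bounded variation on $G$; $\bigvee_G\Omega$ is the total variation of $\Omega$ on $G$; integrals $d\Omega$ are Stieltjes integrals (for $G=\mathbb{R}_+$ a jump of $\Omega$ at $0$ contributes). For $m\in\mathbb{N}$, $\Omega^{[m]}(x)=\frac{1}{(m-1)!}\int_G(x-t)_+^{m-1}\Omega(t)\,dt$, where $x_+=\max\{x;0\}$, and $\Omega^{[0]}=\Omega$. For $\tau>0$, $\mathcal{R}_\tau(x)=x^{\tau-1}/\Gamma(\tau)$ for $x>0$ and $\mathcal{R}_\tau(x)=0$ for $x\leqslant0$. ''Sharp'' means that the constant multiplying the norm of $f^{(r)}$ cannot be replaced by a smaller one. *)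

(* Defs.v *)
(* A function on G is represented by a total function
   R -> R whose values outside G are never used.  "Measurable" means Borel
   measurable; equality of functions is a.e. equality for Lebesgue measure. *)
From HB Require Import structures.
From mathcomp Require Export all_boot all_order all_algebra.
From mathcomp Require Export all_classical all_reals all_analysis.

Set Implicit Arguments.
Unset Strict Implicit.
Unset Printing Implicit Defensive.

Export Order.TTheory GRing.Theory Num.Theory numFieldNormedType.Exports.

Local Open Scope classical_set_scope.
Local Open Scope ring_scope.

Section Defs.
Context {R : realType}.
Implicit Types (G A : set R) (f g Omega : R -> R).

Local Notation mu := (@lebesgue_measure R).

Definition ae_zero_on A f := {ae mu, forall x, A x -> f x = 0}.

Definition Linf_norm G f : \bar R := 'N[mu]_+oo%E[EFin \o (f \_ G)]%E.

(* E is the set of the elements of the space, N its norm. *)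
Record ideal_lattice G (E : set (R -> R)) (N : (R -> R) -> R) : Prop := {
  il_measurable : forall f, E f -> measurable_fun G f;
  il_zero : E (cst 0);
  il_add : forall f g, E f -> E g -> E (f \+ g);
  il_scale : forall (a : R) f, E f -> E (a \*o f);
  il_norm_ge0 : forall f, E f -> 0 <= N f;
  il_norm_eq0 : forall f, E f -> N f = 0 -> ae_zero_on G f;
  il_normD : forall f g, E f -> E g -> N (f \+ g) <= N f + N g;
  il_normZ : forall (a : R) f, E f -> N (a \*o f) = `|a| * N f;
  il_ideal : forall f g, E f -> measurable_fun G g ->
    {ae mu, forall x, G x -> `|g x| <= `|f x|} -> E g /\ N g <= N f }.

Definition semi_shift_invariant G (E : set (R -> R)) (N : (R -> R) -> R) :=
  forall f x, E f -> G x ->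
    [/\ E (fun y => f (y + x)),
        G = [set: R] -> N (fun y => f (y + x)) = N f &
        G = `[0, +oo[%classic -> N (fun y => f (y + x)) <= N f].

(* The support is the smallest set outside of which all the elements of E
   vanish; as these are functions up to a.e. equality, "smallest" and "vanish"
   are up to null sets, and A is unique up to a null set. *)
Definition is_support G (E : set (R -> R)) A :=
  [/\ measurable A, A `<=` G, forall f, E f -> ae_zero_on (G `\` A) f &
      forall B : set R, measurable B -> B `<=` G ->
        (forall f, E f -> ae_zero_on (G `\` B) f) -> mu (A `\` B) = 0%E].

(* When f * g is not integrable for some f in E, the ideal property applied to
   |f| sgn g makes the supremum infinite. *)
Definition assoc_norm G (E : set (R -> R)) (N : (R -> R) -> R) g : \bar R :=
  ereal_sup [set (\int[mu]_(x in G) (f x * g x)%:E)%E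
            | f in [set f | E f /\ N f <= 1]].

Definition assoc_space G (E : set (R -> R)) (N : (R -> R) -> R) :
    set (R -> R) :=
  [set g | [/\ measurable_fun G g,
      exists2 A, is_support G E A & ae_zero_on (G `\` A) g &
      (assoc_norm G E N g < +oo)%E]].

(* Derivative relative to G: one-sided at the endpoint 0 of [0, +oo[. *)
Definition diff_quot f (x y : R) : R := (y - x)^-1 * (f y - f x).

Definition derivable_on G f (x : R) := cvg (diff_quot f x @ within G x^').

Definition derive_on G f (x : R) : R := lim (diff_quot f x @ within G x^').

Definition deriven_on G (j : nat) f : R -> R := iter j (derive_on G) f.

Definition abs_continuous (a b : R) f :=
  forall e : R, 0 < e -> exists2 d : R, 0 < d &
    forall s : seq (R * R),
      (forall p, p \in s -> [/\ a <= p.1, p.1 <= p.2 & p.2 <= b]) ->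
      pairwise (fun p q => (p.2 <= q.1) || (q.2 <= p.1)) s ->
      \sum_(p <- s) (p.2 - p.1) < d ->
      \sum_(p <- s) `|f p.2 - f p.1| < e.

Definition loc_abs_continuous G f :=
  forall a b : R, `[a, b]%classic `<=` G -> abs_continuous a b f.

Definition Lr_space G (r : nat) (E : set (R -> R)) : set (R -> R) :=
  [set f | [/\ measurable_fun G f, (Linf_norm G f < +oo)%E,
      forall j x, (j < r.-1)%N -> G x -> derivable_on G (deriven_on G j f) x,
      loc_abs_continuous G (deriven_on G r.-1 f) &
      E (deriven_on G r f)]].

Definition Wr_class G (r : nat) (E : set (R -> R)) (N : (R -> R) -> R) :
    set (R -> R) :=
  [set f | Lr_space G r E f /\ N (deriven_on G r f) <= 1].

(* Euler's integral on ]0, +oo[, extended to the other x that are not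
   non-positive integers by Gamma (x + m) = x (x + 1) ... (x + m - 1) Gamma x,
   with m the least natural number such that x + m > 0. *)
Definition Gamma_int (x : R) : R :=
  \int[mu]_(t in `]0, +oo[%classic) (t `^ (x - 1) * expR (- t)).

Definition Gamma (x : R) : R :=
  let m := Num.truncn (1 - x) in
  Gamma_int (x + m%:R) / \prod_(i < m) (x + i%:R).

Definition fwd_diff (n : nat) (t : R) f (x : R) : R :=
  \sum_(m < n.+1) (-1) ^+ m * 'C(n, m)%:R * f (x + m%:R * t).

Definition marchaud_cst (k : R) (n : nat) : R :=
  Gamma (- k) * \sum_(m < n.+1) (-1) ^+ m * 'C(n, m)%:R * m%:R `^ k.

Definition marchaud (k : R) (n : nat) f (x : R) : R :=
  (marchaud_cst k n)^-1 *
  \int[mu]_(t in `]0, +oo[%classic) (fwd_diff n t f x / t `^ (1 + k)).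

Definition TV_on G Omega : \bar R :=
  ereal_sup [set total_variation p.1 p.2 Omega
            | p in [set p : R * R | [/\ G p.1, G p.2 & p.1 <= p.2]]].

Definition BV_L1 G : set (R -> R) :=
  [set Omega | mu.-integrable G (EFin \o Omega) /\ (TV_on G Omega < +oo)%E].

(* Riemann-Stieltjes sum for the points a = s_0 < s_1 < ... < s_m = b and the
   tags t_0, ..., t_(m-1), where s = [:: s_1; ...; s_m]. *)
Definition RS_sum (a b : R) f Omega (s t : seq R) : R :=
  \sum_(0 <= i < size s)
    f (nth b t i) * (Omega (nth b (a :: s) i.+1) - Omega (nth b (a :: s) i)).

Definition is_RS_integral (a b : R) f Omega (I : R) :=
  forall e : R, 0 < e -> exists2 d : R, 0 < d &
    forall s t : seq R, itv_partition a b s ->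
      (forall i, (i < size s)%N ->
        [/\ nth b (a :: s) i.+1 - nth b (a :: s) i < d,
            nth b (a :: s) i <= nth b t i &
            nth b t i <= nth b (a :: s) i.+1]) ->
      `|RS_sum a b f Omega s t - I| < e.

(* Improper Stieltjes integral: limit of the integrals on [a, b] as [a, b]
   increases to G.  For G = [0, +oo[ the intervals [0, b] are cofinal, so a jump
   Omega (0+) - Omega 0 contributes. *)
Definition is_stieltjes G f Omega (I : R) :=
  forall e : R, 0 < e -> exists a0 b0 : R, [/\ G a0, G b0, a0 <= b0 &
    forall a b : R, G a -> G b -> a <= a0 -> b0 <= b ->
      exists2 J, is_RS_integral a b f Omega J & `|J - I| < e].

Definition stieltjes G f Omega : R := xget 0 (is_stieltjes G f Omega).

(* The convention is x_+ ^ 0 = 1 for x > 0 and 0 for x <= 0. *)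
Definition trunc_pow (m : nat) (x : R) : R := if 0 < x then x ^+ m else 0.

Definition iter_prim G (m : nat) Omega (x : R) : R :=
  if m is m'.+1 then
    (m'`!%:R)^-1 * \int[mu]_(t in G) (trunc_pow m' (x - t) * Omega t)
  else Omega x.

Definition Rker (tau x : R) : R :=
  if 0 < x then x `^ (tau - 1) / Gamma tau else 0.

Definition rem_ker G (r : nat) (k : R) Omega (x : R) : R :=
  Rker (r%:R - k) x - iter_prim G r.-1 Omega x.

Definition pow_indic (r : nat) (k h x : R) : R :=
  x `^ (r%:R - 1 - k) * \1_(`]0, h[%classic) x.

End Defs.

(* Main.v *)
(* The upper bound is the representation of D^k f(0) applied to the translates
   f(. + x): the Stieltjes integral is at most variation times supremum, and the
   remainder is bounded by duality between E^1 and E.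

   For the extremal Phi the representation gives D^k Phi(0) = V L + A, with V the
   variation of Omega, L = sup |Phi| and A the norm of the remainder kernel. An
   essential supremum does not see the value at 0, so one needs D^k Phi(x) -> D^k
   Phi(0) as x -> 0+. This follows by dominated convergence once the part of the
   Marchaud integral near t = 0 is small uniformly in x. If k < r - 1, then
   Delta^n_{-t} f = O(t^q) for q = min(n, r - 1) > k. If r - 1 < k, then
   |Delta^n_{-t} f(0)| <= C t^(r-1) int_0^(nt) |f^(r)|, and by Tonelli the integral
   over (0, d) is at most a multiple of int_0^(nd) x^(r-1-k) |f^(r)(x)| dx, which
   is small by the hypothesis on E^1; f(. + x) satisfies the same bound.

   Since N(Phi^(r)) <= 1, a constant C with 0 <= C < A is then impossible, and a
   negative C is impossible as soon as A > 0. If A were 0, R_{r-k} and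
   Omega^[r-1] would agree a.e. on G; but the (r-1)-st backward difference with
   step t > x of the latter at x > 0 is O(t^(r-1)), whereas R_{r-k}(x) is of the
   larger order t^(r-1-k) for x comparable to t. *)

From HB Require Import structures.
Require Import Defs.
From mathcomp Require Import measurable_realfun ess_sup_inf lra.

Set Implicit Arguments.
Unset Strict Implicit.
Unset Printing Implicit Defensive.

Local Open Scope classical_set_scope.
Local Open Scope ring_scope.

(** * Absolutely continuous functions *)

Section AbsolutelyContinuous.
Context {R : realType}.
Implicit Types (a b x y : R) (F : R -> R) (s : seq (R * R)).

(** The singular case rests on [|f^(r-1)(y) - f^(r-1)(x)| <= int |f^(r)|], where [f^(r)] is the
    pointwise limit [derive_on], meaningful only almost everywhere. This is derived from absolute
    continuity itself: the variation of [F] is absolutely continuous, the Stieltjes measure of a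
    monotone absolutely continuous function has no mass on null sets, Radon-Nikodym gives a density,
    and Lebesgue differentiation identifies it with the derivative. Translation costs one point: on
    [[0, +oo[] the r-th derivative of [f(. + x)] at 0 is one-sided, so it is compared with the
    translate of [f^(r)] only away from 0; the ideal property absorbs this null set. Integrals and
    limits are total functions here: [Rintegral] is 0 on an infinite integral, [stieltjes] is 0 when
    there is no value. Upper bounds survive these defaults, non-vanishing does not. Hence Euler's
    integral is proved finite before [Gamma] is shown to be nonzero, and integrability of the
    integrand of [Omega^[r-1]] is read off from a nonzero value. *)

Definition nonoverlap a b s :=
  (forall p, p \in s -> [/\ a <= p.1, p.1 <= p.2 & p.2 <= b]) /\
  pairwise (fun p q => (p.2 <= q.1) || (q.2 <= p.1)) s.

Definition chain a (l : seq R) := zip (a :: l) l.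

Lemma chain_nonoverlap a b l : itv_partition a b l -> nonoverlap a b (chain a l).
Proof.
elim: l a => [|x l IH] a abl; first by split.
have /itv_partition_cons xbl := abl; have [h1 h2] := IH _ xbl.
have ax : a < x by case: abl => /= /andP[].
have xb : x <= b := itv_partition_le xbl.
split => [p|/=].
  rewrite inE => /orP[/eqP -> /=|/h1[? ? ?]]; first by split => //; exact: ltW.
  by split => //; apply: le_trans (ltW ax) _.
apply/andP; split; last exact: h2.
by apply/allP => q /h1[-> _ _].
Qed.

Lemma chain_len a b l : itv_partition a b l ->
  \sum_(p <- chain a l) (p.2 - p.1) = b - a.
Proof.
elim: l a => [|x l IH] a abl.
  by rewrite big_nil (itv_partition_nil abl) subrr.
rewrite /chain /= big_cons /= (IH _ (itv_partition_cons abl)); lra.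
Qed.

Lemma chain_variation a b F l : itv_partition a b l ->
  \sum_(p <- chain a l) `|F p.2 - F p.1| = variation a b F l.
Proof.
move=> /variation_zip ->; rewrite /chain.
elim: l a => [|x l IH] a; first by rewrite !big_nil.
by rewrite /= !big_cons /= IH.
Qed.

Lemma sub_nonoverlap a b x y s : a <= x -> y <= b ->
  nonoverlap x y s -> nonoverlap a b s.
Proof.
move=> ax yb [h1 h2]; split => // p /h1[? ? ?].
by split => //; [exact: le_trans ax _|exact: le_trans yb].
Qed.

(** With [d] the modulus for 1, the variation over any piece shorter than [d] is at most 1; pieces
    of length [d / 2] lead from [a] to [b] in finitely many steps. *)
Lemma abs_continuous_bounded_variation a b F : a <= b ->
  abs_continuous a b F -> bounded_variation a b F.
Proof.
move=> ab acF; have [d d0 Hd] := acF 1 ltr01.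
have small x y : a <= x -> x <= y -> y <= b -> y - x < d ->
    (total_variation x y F <= 1%:E)%E.
  move=> ax xy yb xyd; apply: ge_ereal_sup => _ [_ [l xyl <-] <-].
  rewrite lee_fin -(chain_variation _ xyl); apply: ltW.
  have [h1 h2] := sub_nonoverlap ax yb (chain_nonoverlap xyl).
  by apply: Hd => //; rewrite (chain_len xyl).
(* [N.+1] pieces of length [d / 2] cover [[a, b]]. *)
pose N := Num.truncn (2 * (b - a) / d).
have step j x : a <= x -> x <= b -> x - a <= j%:R * (d / 2) ->
    (total_variation a x F < +oo)%E.
  elim: j x => [|j IH] x ax xb xj.
    have -> : x = a by apply/eqP; rewrite eq_le ax andbT -subr_le0 (le_trans xj) ?mul0r.
    by rewrite total_variationxx ltry.
  pose y := Num.max a (x - d / 2).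
  have ay : a <= y by rewrite le_max lexx.
  have yx : y <= x by rewrite ge_max ax gerBl; apply/divr_ge0 => //; exact: ltW.
  rewrite (total_variationD _ ay yx) lte_add_pinfty //.
    apply: IH => //; first exact: le_trans yx xb.
    rewrite /y maxEle; case: ifP => _; first by move: xj; rewrite -natr1 => ?; lra.
    by rewrite subrr mulr_ge0 // divr_ge0 // ltW.


  apply: le_lt_trans (small y x ay yx xb _) (ltry _).
  by apply: (@le_lt_trans _ _ (d / 2)); last lra; rewrite lerBlDl -lerBlDr le_max lexx orbT.
apply/(bounded_variationP _ ab); rewrite ge0_fin_numE ?total_variation_ge0 //.
apply: (step N.+1) => //.
have : 2 * (b - a) / d <= N.+1%:R by apply/ltW/truncnS_gt.
by rewrite ler_pdivrMr // => ?; lra.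
Qed.

(** Each interval of [s] is replaced by a partition of it that nearly attains the variation there,
    with error [e / 2] for the head and [e / 2] left for the rest. The total length is unchanged, so
    the modulus of [F] applies to [t]. The last clause keeps pieces of different intervals apart in
    the induction. *)
Lemma nonoverlap_refine a b F s (e : R) : 0 < e -> bounded_variation a b F ->
  nonoverlap a b s ->
  exists2 t, nonoverlap a b t &
   [/\ \sum_(p <- t) (p.2 - p.1) = \sum_(p <- s) (p.2 - p.1),
     \sum_(p <- s) (fine (total_variation a p.2 F) - fine (total_variation a p.1 F))
       <= \sum_(p <- t) `|F p.2 - F p.1| + e &
     forall q, q \in t -> exists2 p, p \in s & p.1 <= q.1 /\ q.2 <= p.2].
Proof.
move=> + bvF; elim: s e => [|p s IH] e e0 hs.
  by exists [::] => //; split; rewrite ?big_nil ?add0r ?ltW.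
have [h1 /= /andP[/allP h2 h3]] := hs.
have hs' : nonoverlap a b s by split => // q qs; apply: h1; rewrite inE qs orbT.
have e20 : 0 < e / 2 by rewrite divr_gt0.
have [t [t1 t2] [tl tv ts]] := IH _ e20 hs'.
have [ap pp pb] := h1 p (mem_head _ _).
have bvp : bounded_variation p.1 p.2 F.
  apply: (@bounded_variationl _ _ _ b) => //.
  by apply: (bounded_variationr _ _ bvF) => //; exact: le_trans pp pb.
have fin x : a <= x -> x <= b -> total_variation a x F \is a fin_num.
  by move=> ax xb; apply/(bounded_variationP _ ax)/(bounded_variationl ax xb).
have finp : total_variation p.1 p.2 F \is a fin_num by apply/bounded_variationP.
have [_ [_ [l pl <-] <-] lv] := ub_ereal_sup_adherent e20 finp.
have [c1 c2] := chain_nonoverlap pl.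
exists (chain p.1 l ++ t).
  split => [q|].
    rewrite mem_cat => /orP[/c1[? ? ?]|/t1//].
    by split => //; [exact: le_trans ap _|exact: le_trans pb].
  rewrite pairwise_cat c2 t2 !andbT; apply/allrelP => q r /c1[q1 q2 q3] /ts[u us [u1 u2]].
  have /orP[h|h] := h2 u us.
    by rewrite (le_trans q3 (le_trans h u1)).
  by rewrite (le_trans u2 (le_trans h q1)) orbT.
split; first by rewrite big_cat big_cons /= tl (chain_len pl).
  rewrite big_cat big_cons /= (chain_variation F pl).
  rewrite -/(total_variation _ _ _) in lv.
  rewrite (total_variationD F ap pp) fineD // ?fin //; last exact: le_trans pp pb.
  move: lv; rewrite -[X in (X - _ < _)%E]fineK // -EFinB lte_fin => lv; lra.
move=> q; rewrite mem_cat => /orP[/c1[? ? ?]|/ts[u us ?]].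
  by exists p => //; rewrite mem_head.
by exists u => //; rewrite inE us orbT.
Qed.

(** By [nonoverlap_refine], increments of the variation over [s] are, up to [e / 2], increments of
    [F] over a family of the same total length. *)
Lemma abs_continuous_total_variation a b F : a <= b ->
  abs_continuous a b F ->
  abs_continuous a b (fun x => fine (total_variation a x F)).
Proof.
move=> ab acF e e0; have bvF := abs_continuous_bounded_variation ab acF.
have e20 : 0 < e / 2 by rewrite divr_gt0.
have [d d0 Hd] := acF _ e20; exists d => // s s1 s2 sd.
have [t [t1 t2] [tl tv _]] := nonoverlap_refine e20 bvF (conj s1 s2).
have -> : \sum_(p <- s) `|fine (total_variation a p.2 F) - fine (total_variation a p.1 F)|
   = \sum_(p <- s) (fine (total_variation a p.2 F) - fine (total_variation a p.1 F)).
  apply: eq_big_seq => p /s1[ap pp pb]; rewrite ger0_norm // subr_ge0.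
  have fin x : a <= x -> x <= b -> total_variation a x F \is a fin_num.
    by move=> ax xb; apply/(bounded_variationP _ ax)/(bounded_variationl ax xb).
  apply: fine_le; [exact/fin/(le_trans pp)|apply: fin => //; exact: le_trans pp|].
  by rewrite (total_variationD F ap pp) leeDl // total_variation_ge0.
have : \sum_(p <- t) `|F p.2 - F p.1| < e / 2 by apply: Hd => //; rewrite tl.
lra.
Qed.

Lemma abs_continuousB a b F1 F2 :
  abs_continuous a b F1 -> abs_continuous a b F2 -> abs_continuous a b (F1 \- F2).
Proof.
move=> ac1 ac2 e e0; have e20 : 0 < e / 2 by rewrite divr_gt0.
have [d1 d10 H1] := ac1 _ e20; have [d2 d20 H2] := ac2 _ e20.
exists (Num.min d1 d2); first by rewrite lt_min d10.
move=> s s1 s2; rewrite lt_min => /andP[sd1 sd2].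
have h1 := H1 s s1 s2 sd1; have h2 := H2 s s1 s2 sd2.
apply: (@le_lt_trans _ _ (\sum_(p <- s) `|F1 p.2 - F1 p.1| + \sum_(p <- s) `|F2 p.2 - F2 p.1|)); last lra.
rewrite -big_split; apply: ler_sum => p _ /=.
have -> : F1 p.2 - F2 p.2 - (F1 p.1 - F2 p.1) = (F1 p.2 - F1 p.1) - (F2 p.2 - F2 p.1) by lra.
exact: ler_normB.
Qed.

Lemma abs_continuous_dist a b F (e : R) : abs_continuous a b F -> 0 < e ->
  exists2 d : R, 0 < d & forall x y, a <= x -> x <= y -> y <= b -> y - x < d ->
    `|F y - F x| < e.
Proof.
move=> acF e0; have [d d0 Hd] := acF e e0; exists d => // x y ax xy yb xyd.
have := Hd [:: (x, y)]; rewrite !big_cons !big_nil /= !addr0; apply => //.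
by move=> p; rewrite inE => /eqP ->.
Qed.

End AbsolutelyContinuous.

(** * Radon-Nikodym density of a monotone absolutely continuous function *)

Section MonotoneDensity.
Context {R : realType}.
Local Notation mu := (@lebesgue_measure R).
Implicit Types (a b x y : R) (V : R -> R).

(** The pair is [(inf J, sup J)], or [(a, a)] when [J] is empty. Having no least element, [J] is
    open on the left, which fits the half-open intervals on which a Stieltjes measure is known. *)
Lemma interval_endpoints a b (J : set R) : a <= b -> is_interval J ->
  J `<=` `]a, b] -> (forall x, J x -> exists2 y, J y & y < x) ->
  exists p : R * R, [/\ [/\ a <= p.1, p.1 <= p.2 & p.2 <= b], p.1 < p.2 \/ p.2 = a,
    J `<=` `]p.1, p.2] & `]p.1, p.2[ `<=` J].
Proof.
move=> ab iJ Jab Jl.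
have [->|/set0P[x0 Jx0]] := eqVneq J set0.
  exists (a, a); split => //=; first by right. move=> x /=; rewrite in_itv /= => /andP[h1 h2].
  by have := lt_trans h1 h2; rewrite ltxx.
have Jlow : lbound J a by move=> x /Jab /=; rewrite in_itv /= => /andP[/ltW].
have Jup : ubound J b by move=> x /Jab /=; rewrite in_itv /= => /andP[].
have hi : has_inf J by split; [exists x0|exists a].
have hs : has_sup J by split; [exists x0|exists b].
exists (inf J, sup J) => /=; split.
- split; first by apply: lb_le_inf => //; exists x0.
    by apply: (@le_trans _ _ x0); [apply: ge_inf; case: hi|apply: ub_le_sup => //; case: hs].
  by apply: ge_sup => //; exists x0.
- have [y Jy yx0] := Jl _ Jx0; left; apply: (@lt_le_trans _ _ x0).
    by apply: le_lt_trans yx0; apply: ge_inf => //; case: hi.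
  by apply: ub_le_sup => //; case: hs.
- move=> x Jx /=; rewrite in_itv /=; apply/andP; split; last by apply: ub_le_sup => //; case: hs.
  have [y Jy yx] := Jl _ Jx; apply: le_lt_trans yx; apply: ge_inf => //; case: hi => //.
- move=> x /=; rewrite in_itv /= => /andP[h1 h2].
  have [y Jy yx] := inf_lt (proj1 hi) h1.
  have [z Jz xz] := sup_gt (proj1 hs) h2.
  by apply: (iJ y z) => //; rewrite !ltW.
Qed.

Lemma stieltjes_measure_ex V : nondecreasing V -> right_continuous V ->
  exists nu : {measure set (measurableTypeR R) -> \bar R},
    forall x y, x <= y -> nu `]x, y]%classic = (V y - V x)%:E.
Proof.
move=> ndV rcV.
pose cV : cumulative R R := HB.pack V (isCumulative.Build R _ R V ndV rcV).
exists (lebesgue_stieltjes_measure cV) => x y xy.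
rewrite /= /lebesgue_stieltjes_measure /measure_extension.
rewrite (measurable_mu_extE (wlength cV)); last exact: is_ocitv.
exact: (wlength_itv_bnd V false false xy).
Qed.

(* A is covered by an open U with mu U < d; the traces on ]a, b] of its
   components are disjoint intervals of total length < d, so V increases by less
   than e over finitely many of them. *)
Lemma abs_continuous_null a b V (nu : {measure set (measurableTypeR R) -> \bar R})
    (A : set R) : a < b -> abs_continuous a b V ->
  (forall x y, a <= x -> x <= y -> y <= b -> nu `]x, y]%classic = (V y - V x)%:E) ->
  measurable A -> mu A = 0%E -> nu (A `&` `]a, b]) = 0%E.
Proof.
move=> ab acV nuE mA muA.
apply/eqP; rewrite eq_le measure_ge0 andbT; apply/lee_addgt0Pr => e e0; rewrite add0e.
have [d d0 Hd] := acV e e0.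
have [U [oU AU muU]] : exists U, [/\ open U, A `<=` U & (mu (U `\` A) < d%:E)%E].
  by apply: lebesgue_regularity_outer => //; rewrite [ltLHS]muA ltry.
have {}muU : (mu U < d%:E)%E.
  rewrite -(setDUK AU); apply: le_lt_trans muU.
  rewrite (le_trans (measureU2 _ _ _)) //; last by rewrite [X in (X + _)%E]muA add0e.
  by apply: measurableD => //; exact: open_measurable.
pose J i : set (measurableTypeR R) := open_disjoint_itv oU i `&` `]a, b].
have mJ i : measurable (J i).
  by apply: measurableI => //; apply: open_measurable; exact: open_disjoint_itv_open.
have tJ : trivIset setT J.
  by apply: trivIset_setIr; exact: open_disjoint_itv_trivIset.
have /choice[p Hp] : forall i, exists p : R * R,
   [/\ [/\ a <= p.1, p.1 <= p.2 & p.2 <= b], p.1 < p.2 \/ p.2 = a,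
     J i `<=` `]p.1, p.2] & `]p.1, p.2[ `<=` J i].
  move=> i; apply: interval_endpoints; first exact: ltW.
  - move=> x y [xU xab] [yU yab] z xyz; split.
      exact: (open_disjoint_itv_is_interval xU yU).
    move: xab yab xyz; rewrite /= !in_itv /= => /andP[h1 h2] /andP[h3 h4] /andP[h5 h6].
    by rewrite (lt_le_trans h1 h5) (le_trans h6 h4).
  - by move=> x [].
  - move=> x [xU /=]; rewrite in_itv /= => /andP[ax xb].
    near x^'- => y; have yx : y < x by near: y; exact: nbhs_left_lt.
    exists y => //; split.
      near: y; apply: cvg_within; apply: open_nbhs_nbhs; split => //.
      exact: open_disjoint_itv_open.
    rewrite /= in_itv /= (le_trans (ltW yx) xb) andbT.
    by near: y; exact: nbhs_left_gt.
have AJ : A `&` `]a, b] `<=` \bigcup_i J i.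
  rewrite -setI_bigcupl -open_disjoint_itv_bigcup => x [Ax ?]; split => //; exact: AU.
apply: (@le_trans _ _ (nu (\bigcup_i J i))).
  apply: le_measure => //; rewrite inE; first exact: measurableI.
  exact: bigcup_measurable.
rewrite measure_bigcup //=.
rewrite (eq_eseriesl (Q := xpredT)); last by move=> i; rewrite in_setT.
apply: lime_le; first by apply: is_cvg_nneseries => i _ _; exact: measure_ge0.
near=> m.
have muJ : (\sum_(0 <= i < m) mu (J i) < d%:E)%E.
  apply: le_lt_trans muU.
  apply: (@le_trans _ _ (mu (\bigcup_i J i))).
    rewrite measure_bigcup //= (eq_eseriesl (Q := xpredT)); last by move=> i; rewrite in_setT.
    by apply: nneseries_lim_ge => i _ _; exact: measure_ge0.
  apply: le_measure; rewrite ?inE; first exact: bigcup_measurable.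
    exact: open_measurable.
  by move=> x [i _ [xi _]]; rewrite (open_disjoint_itv_bigcup oU); exists i.
pose s := [seq p i | i <- index_iota 0 m].
have : \sum_(q <- s) `|V q.2 - V q.1| < e.
  apply: Hd.
  - by move=> q /mapP[i _ ->]; case: (Hp i).
  - rewrite pairwise_map; apply: (@sub_in_pairwise _ predT ltn); last first.
    + by rewrite -(sorted_pairwise ltn_trans); exact: iota_ltn_sorted.
    + by apply/allP.
    move=> i j _ _ ij /=; apply/negPn/negP; rewrite negb_or -!ltNge => /andP[h1 h2].
    have [[ai _ _] i1 _ iJ] := Hp i; have [[aj _ _] j1 _ jJ] := Hp j.
    case: i1 => [i1|i1]; last by move: h1; rewrite i1 ltNge aj.
    case: j1 => [j1|j1]; last by move: h2; rewrite j1 ltNge ai.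
    (* If the two intervals overlapped, the midpoint of the overlap would lie in two disjoint
       traces. *)
    pose l := Num.max (p i).1 (p j).1; pose u := Num.min (p i).2 (p j).2.
    have [zi zj] : J i ((l + u) / 2) /\ J j ((l + u) / 2).
      have lu : l < u by rewrite /l /u gt_max !lt_min h1 h2 i1 j1.
      have : (p i).1 <= l by rewrite le_max lexx.
      have : (p j).1 <= l by rewrite le_max lexx orbT.
      have : u <= (p i).2 by rewrite ge_min lexx.
      have : u <= (p j).2 by rewrite ge_min lexx orbT.
      by move=> *; split; [apply: iJ|apply: jJ]; rewrite /= in_itv /=; apply/andP; split; lra.
    have : (J i `&` J j) !=set0 by exists ((l + u) / 2).
    by move/(tJ i j Logic.I Logic.I) => h; have : (i < j)%N := ij; rewrite h ltnn.
  - rewrite big_map -lte_fin -sumEFin; apply: le_lt_trans muJ; apply: lee_sum => i _.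
    have [[_ i1 _] _ _ iJ] := Hp i.
    rewrite -(_ : mu `](p i).1, (p i).2[ = ((p i).2 - (p i).1)%:E).
      by apply: le_measure => //; rewrite inE.
    rewrite lebesgue_measure_itv /= lte_fin; case: ltP => // i2.
    by have -> : (p i).2 = (p i).1; [apply/eqP; rewrite eq_le i1 i2|rewrite subrr].
move/ltW; rewrite -lee_fin; apply: le_trans; rewrite big_map -sumEFin; apply: lee_sum => i _.
have [[ai i1 ib] _ iJ _] := Hp i.
apply: (@le_trans _ _ (nu `](p i).1, (p i).2]%classic)).
  by apply: le_measure => //; rewrite inE.
by rewrite nuE // lee_fin ler_norm.
Unshelve. all: by end_near.
Qed.

(** A Stieltjes measure needs a function monotone on the whole line, so [V] is extended by constants
    through the clamp [cl]. Absolute continuity makes the restriction of the measure to []a, b]]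
    vanish on null sets, and Radon-Nikodym applies. *)
Lemma monotone_abs_continuous_density a b V : a < b ->
  {in `[a, b] &, nondecreasing_fun V} -> abs_continuous a b V ->
  exists g : R -> R, [/\ mu.-integrable setT (EFin \o g), forall x, 0 <= g x &
    forall x y, a <= x -> x <= y -> y <= b ->
      (\int[mu]_(t in `]x, y]) (g t)%:E = (V y - V x)%:E)%E].
Proof.
move=> ab ndV acV.
pose cl x := Num.max a (Num.min x b).
have cl_ge x : a <= cl x by rewrite le_max lexx.
have cl_le x : cl x <= b by rewrite ge_max (ltW ab) /= ge_min lexx orbT.
have cl_id x : a <= x -> x <= b -> cl x = x.
  by move=> ax xb; rewrite /cl (min_idPl xb) (max_idPr ax).
have cl_nd x y : x <= y -> cl x <= cl y.
  move=> xy; rewrite /cl ge_max le_max lexx /= le_max; apply/orP; right.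
  by rewrite le_min !ge_min xy lexx /= orbT.
have cl_lip x y : x <= y -> cl y - cl x <= y - x.
  move=> xy; rewrite lerBlDr {1}/cl ge_max; apply/andP; split.
    by have := cl_ge x; lra.
  have : Num.min x b <= cl x by rewrite le_max lexx orbT.
  have : Num.min y b <= y by rewrite ge_min lexx.
  have : Num.min y b <= b by rewrite ge_min lexx orbT.
  by case: (leP x b) => ?; lra.
pose V' x := V (cl x).
have ndV' : nondecreasing V'.
  by move=> x y xy; apply: ndV; rewrite ?in_itv /= ?cl_ge ?cl_le //; exact: cl_nd.
have rcV' : right_continuous V'.
  move=> x; apply/cvgrPdist_lt => e e0.
  have [d d0 Hd] := abs_continuous_dist acV e0.
  near=> y.
  have xy : x <= y by near: y; exact: nbhs_right_ge.
  rewrite distrC; apply: Hd => //; first exact: cl_nd.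
  apply: le_lt_trans (cl_lip _ _ xy) _; rewrite ltrBlDl.
  by near: y; apply: nbhs_right_lt; rewrite ltrDl.
have [nu nuE] := stieltjes_measure_ex ndV' rcV'.
have mD : measurable (`]a, b]%classic : set (measurableTypeR R)) by exact: measurable_itv.
have nuD : (nu `]a, b]%classic < +oo)%E by rewrite nuE ?ltry // ltW.
pose nuab : {finite_measure set (measurableTypeR R) -> \bar R} := mfrestr mD nuD.
have dom : nuab `<< mu.
  apply/null_content_dominatesP => A mA muA.
  rewrite /nuab /= /mfrestr /mrestr /=; apply: abs_continuous_null acV _ mA muA => //.
  move=> x y ax xy yb; by rewrite nuE // /V' !cl_id // ?(le_trans ax xy) ?(le_trans xy yb).
have [g [g0 gfin ig nug]] := radon_nikodym_sigma_finite dom.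
exists (fine \o g); split.
- by apply: eq_integrable ig => // x _ /=; rewrite fineK.
- by move=> x; exact: fine_ge0.
- move=> x y ax xy yb; transitivity (nuab `]x, y]%classic).
    by rewrite nug //; apply: eq_integral => t _; rewrite fineK.
  rewrite /nuab /= /mfrestr /mrestr setIidl.
    by rewrite nuE // /V' !cl_id // ?(le_trans ax xy) ?(le_trans xy yb).
  by apply: subset_itv; rewrite bnd_simp.
Unshelve. all: by end_near.
Qed.

End MonotoneDensity.

(** * Increments bounded by the integral of the derivative *)

Section FTC.
Context {R : realType}.
Local Notation mu := (@lebesgue_measure R).
Implicit Types (a b x y : R) (F g : R -> R).

(* F = V - (V - F) with V the total variation of F: both terms are nondecreasing
   and absolutely continuous, so each has a Radon-Nikodym density. *)
Lemma abs_continuous_primitive a b F : a < b -> abs_continuous a b F ->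
  exists h : R -> R, mu.-integrable setT (EFin \o h) /\
    forall y, a <= y -> y <= b -> F y = F a + \int[mu]_(t in `]a, y]) h t.
Proof.
move=> ab acF; have acV := abs_continuous_total_variation (ltW ab) acF.
have bvF := abs_continuous_bounded_variation (ltW ab) acF.
set V := (fun x => fine _) in acV.
have dV x y : a <= x -> x <= y -> y <= b -> `|F y - F x| <= V y - V x.
  move=> ax xy yb.
  have fin z : a <= z -> z <= b -> total_variation a z F \is a fin_num.
    by move=> az zb; apply/(bounded_variationP _ az)/(bounded_variationl az zb).
  have bvxy : bounded_variation x y F.
    apply: (@bounded_variationl _ _ _ b) => //.
    by apply: (bounded_variationr _ _ bvF) => //; exact: le_trans xy yb.
  have fxy : total_variation x y F \is a fin_num by apply/bounded_variationP.
  rewrite /V (total_variationD F ax xy) fineD ?fin ?(le_trans xy yb) //.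
  rewrite addrAC subrr add0r -lee_fin fineK //; exact: total_variation_ge.
have acW := abs_continuousB acV acF.
have ndV : {in `[a, b] &, nondecreasing_fun V}.
  move=> x y; rewrite !in_itv /= => /andP[ax xb] /andP[ay yb] xy.
  by rewrite -subr_ge0; apply: le_trans (dV _ _ ax xy yb).
have ndW : {in `[a, b] &, nondecreasing_fun (V \- F)}.
  move=> x y; rewrite !in_itv /= => /andP[ax xb] /andP[ay yb] xy /=.
  by have := le_trans (ler_norm _) (dV _ _ ax xy yb); lra.
have [gV [iV _ EV]] := monotone_abs_continuous_density ab ndV acV.
have [gW [iW _ EW]] := monotone_abs_continuous_density ab ndW acW.
exists (gV \- gW); split.
  have -> : EFin \o (gV \- gW) = ((EFin \o gV) \- (EFin \o gW))%E by apply/funext.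
  exact: integrableB.
move=> y ay yb; rewrite RintegralB //; [|exact: integrableS iV|exact: integrableS iW].
rewrite /Rintegral (EV a y) // (EW a y) //= ; lra.
Qed.

(** At almost every point the primitive of the density of [F] has that density as derivative, so [g]
    equals it there. [g] is tied to [F] only where [F] is differentiable, because [derive_on] is an
    arbitrary value elsewhere. *)
Lemma abs_continuous_le_integral a b F g : a <= b -> abs_continuous a b F ->
  measurable_fun `]a, b[ g ->
  (forall x, a < x -> x < b -> derivable F x 1 -> g x = derive1 F x) ->
  (`|F b - F a|%:E <= \int[mu]_(t in `]a, b[) `|g t|%:E)%E.
Proof.
rewrite le_eqVlt => /predU1P[->|ab] acF mg gF.
  by rewrite subrr normr0; apply: integral_ge0.
have [h [ih Fh]] := abs_continuous_primitive ab acF.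
have loch : locally_integrable setT h by apply: open_integrable_locally => //; exact: openT.
have ihA (A : set R) : measurable A -> mu.-integrable A (EFin \o h).
  by move=> mA; apply: integrableS ih.
have ae := FTC1 (a := BRight a) (fun y => ihA _ (measurable_itv _)) loch.
have aeg : ae_eq mu `]a, b[%classic (fun t => `|h t|%:E) (fun t => `|g t|%:E).
  move: ae; apply: filterS; first exact: (ae_filter_ringOfSetsType mu).
  move=> x Hx; rewrite /= in_itv /= => /andP[ax xb].
  have [|dP DP] := Hx; first by rewrite lte_fin.
  pose P y := F a + \int[mu]_(t in `]a, y]) h t.
  have FP : \near x, P x = F x.
    near=> y; rewrite /P -Fh //; apply: ltW.
      by near: y; exact: lt_nbhsr.
    by near: y; exact: lt_nbhsl.
  have dP' : derivable P x 1 by apply: derivableD => //; exact: derivable_cst.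
  have dF : derivable F x 1 by exact: near_eq_derivable FP dP'.
  have -> // : g x = h x.
  rewrite gF // -DP !derive1E -(near_eq_derive _ FP) deriveD //.
  by rewrite derive_cst add0r.
have mh : measurable_fun `]a, b[ h.
  apply: (@measurable_funS _ _ _ _ setT) => //.
  by move/integrableP : ih => -[/measurable_EFinP].
rewrite -(ae_eq_integral _ _ _ _ _ aeg) //; try by apply/measurable_EFinP; exact: measurableT_comp.
rewrite (Fh b) // ?(ltW ab) // (Fh a) // ?(ltW ab) // set_itvoc0 Rintegral_set0 addr0 addrAC subrr add0r.
rewrite EFin_normr_Rintegral //; last exact: ihA.
apply: le_trans (le_abse_integral _ _ _) _ => //.
  by apply: measurable_int; exact: ihA.
rewrite -integral_itv_bndo_bndc //.
by apply: measurableT_comp => //; apply/measurable_EFinP.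
Unshelve. all: by end_near.
Qed.

End FTC.

(** * Finite differences and derivatives relative to G *)

Section ForwardDifferences.
Context {R : realType}.
Implicit Types (f : R -> R) (t x y : R).

Lemma fwd_diff0 t f y : fwd_diff 0 t f y = f y.
Proof. by rewrite /fwd_diff big_ord1 bin0 !mul1r mul0r addr0. Qed.

Lemma fwd_diffS q t f y :
  fwd_diff q.+1 t f y = fwd_diff q t f y - fwd_diff q t f (y + t).
Proof.
have -> : fwd_diff q t f y =
    f y + \sum_(m < q.+1) (-1) ^+ m.+1 * 'C(q, m.+1)%:R * f (y + m.+1%:R * t).
  transitivity (\sum_(m < q.+2) (-1) ^+ m * 'C(q, m)%:R * f (y + m%:R * t)).
    by rewrite big_ord_recr /= bin_small // mulr0 mul0r addr0.
  by rewrite big_ord_recl /= bin0 !mul1r mul0r addr0.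
rewrite /fwd_diff big_ord_recl /= bin0 !mul1r mul0r addr0 -addrA -sumrB; congr (_ + _).
apply: eq_bigr => m _; rewrite /bump /= add1n binS natrD exprS.
have -> : y + t + m%:R * t = y + m.+1%:R * t by rewrite -natr1; lra.
lra.
Qed.

Lemma fwd_diffB q t f g y :
  fwd_diff q t (f \- g) y = fwd_diff q t f y - fwd_diff q t g y.
Proof.
by rewrite /fwd_diff -sumrB; apply: eq_bigr => m _ /=; rewrite mulrBr.
Qed.

Lemma fwd_diff_shift q t x f y :
  fwd_diff q t (fun z => f (z + x)) y = fwd_diff q t f (y + x).
Proof. by apply: eq_bigr => m _; congr (_ * f _); lra. Qed.

Lemma fwd_diffSr q t f y :
  fwd_diff q.+1 t f y = fwd_diff q t (f \- fun z => f (z + t)) y.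
Proof. by rewrite fwd_diffB fwd_diff_shift fwd_diffS. Qed.

(** Each of the [d] extra differences at most doubles the bound. *)
Lemma fwd_diff_le_add q d t f y (B : R) :
  (forall i, (i <= d)%N -> `|fwd_diff q t f (y + i%:R * t)| <= B) ->
  `|fwd_diff (q + d) t f y| <= 2 ^+ d * B.
Proof.
elim: d y => [|d IH] y H.
  by rewrite addn0 mul1r; have := H 0%N (leqnn _); rewrite mul0r addr0.
rewrite addnS fwd_diffS; apply: le_trans (ler_normB _ _) _.
have -> : 2 ^+ d.+1 * B = 2 ^+ d * B + 2 ^+ d * B by rewrite exprS; lra.
apply: lerD; apply: IH => i id.
  by apply: H; exact: leqW.
have -> : y + t + i%:R * t = y + i.+1%:R * t by rewrite -natr1; lra.
exact: H.
Qed.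

Lemma fwd_diff_le n t f y (B : R) :
  (forall i, (i <= n)%N -> `|f (y + i%:R * t)| <= B) ->
  `|fwd_diff n t f y| <= 2 ^+ n * B.
Proof.
move=> H; rewrite -[n in fwd_diff n]add0n; apply: fwd_diff_le_add => i /H.
by rewrite fwd_diff0.
Qed.

End ForwardDifferences.

(** * Derivatives relative to the domain, and the mean value theorem for differences *)

Section RelativeCalculus.
Context {R : realType}.
Variable G : set R.
Hypothesis hG : G = `[0, +oo[%classic \/ G = [set: R].
Implicit Types (F H : R -> R) (x y t : R).

Lemma dom0 : G 0.
Proof. by case: hG => -> //=; rewrite in_itv /= lexx. Qed.

Lemma dom_up x y : G x -> x <= y -> G y.
Proof. by case: hG => -> //=; rewrite !in_itv /= !andbT => /le_trans h /h. Qed.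

Lemma domD x y : G x -> G y -> G (x + y).
Proof. by case: hG => -> //=; rewrite !in_itv /= !andbT; exact: addr_ge0. Qed.

Lemma dom_nneg x : 0 <= x -> G x.
Proof. exact: dom_up dom0. Qed.

Lemma measurable_dom : measurable G.
Proof. by case: hG => ->; [exact: measurable_itv|exact: measurableT]. Qed.

Lemma dom_itv x y : G x -> `[x, y] `<=` G.
Proof. by move=> Gx z /=; rewrite in_itv /= => /andP[/(dom_up Gx)]. Qed.

Lemma nbhs_dom x y : G x -> x < y -> nbhs y G.
Proof.
by move=> Gx xy; near=> z; apply: (dom_up Gx); apply: ltW; near: z; exact: lt_nbhsr.
Unshelve. all: by end_near. Qed.

Lemma nbhs_dom_neq0 x : G x -> x != 0 -> nbhs x G.
Proof.
case: (hG) => GE; last by move=> _ _; rewrite GE; exact: filterT.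
move=> Gx x0; apply: (nbhs_dom dom0); rewrite lt_neqAle eq_sym x0.
by move: Gx; rewrite GE /= in_itv /= andbT.
Qed.

(** [G] has points to the right of each of its points; this makes limits relative to [G] unique. *)
Lemma within_dom_proper x : G x -> ProperFilter (within G x^').
Proof.
move=> Gx; split; last exact: within_filter.
rewrite /within /= => /nbhs_ballP[e /= e0 H].
apply: (H (x + e / 2)).
- by rewrite /ball /= opprD addNKr normrN gtr0_norm; lra.
- by rewrite gt_eqF // ltrDl; lra.
- by apply: (dom_up Gx); lra.
Qed.

(** A relation rather than [derive_on], so that differences of translates keep explicit
    derivatives. *)
Definition hasder F F' := forall x, G x -> diff_quot F x @ within G x^' --> F' x.

Lemma derivable_on_hasder F : (forall x, G x -> derivable_on G F x) ->
  hasder F (derive_on G F).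
Proof. by move=> h x /h. Qed.

Lemma hasder_derive_on F F' x : hasder F F' -> G x -> derive_on G F x = F' x.
Proof.
move=> h Gx; apply: cvg_lim (h x Gx) => //.
exact: within_dom_proper.
Qed.

Lemma hasder_derivable F F' x : hasder F F' -> G x -> derivable_on G F x.
Proof. by move=> h Gx; apply/cvg_ex; exists (F' x); exact: h. Qed.

Lemma hasderP F F' : hasder F F' <-> forall x, G x -> forall e, 0 < e ->
  \forall y \near x, y != x -> G y -> `|F' x - diff_quot F x y| < e.
Proof.
split=> h x Gx.
  have := h x Gx => /cvgrPdist_lt hx e e0.
  by have := hx e e0; rewrite !near_withinE /=; apply: filterS => y h1 h2 h3; apply: h1.
apply/cvgrPdist_lt => e e0; rewrite !near_withinE /=.
by have := h x Gx e e0; apply: filterS => y h1 h2 h3; apply: h1.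
Qed.

Lemma hasder_ext F F' H H' : {in G, F =1 H} -> {in G, F' =1 H'} ->
  hasder F F' -> hasder H H'.
Proof.
move=> FH FH' /hasderP h; apply/hasderP => x Gx e e0.
have := h x Gx e e0; apply: filterS => y h1 yx Gy.
by rewrite -FH' ?inE // /diff_quot -!FH ?inE //; exact: h1.
Qed.

Lemma hasder_shift F F' t : G t -> hasder F F' ->
  hasder (fun z => F (z + t)) (fun z => F' (z + t)).
Proof.
move=> Gt /hasderP h; apply/hasderP => x Gx e e0.
have := h (x + t) (domD Gx Gt) e e0; rewrite (near_shift x) /=.
apply: filterS => y /=; rewrite [x + t - x]addrC addKr => h1 yx Gy.
have -> : diff_quot (fun z => F (z + t)) x y = diff_quot F (x + t) (y + t).
  by rewrite /diff_quot; congr (_^-1 * _); lra.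
by apply: h1; [rewrite (inj_eq (addIr _))|exact: domD].
Qed.

Lemma hasderB F F' H H' : hasder F F' -> hasder H H' -> hasder (F \- H) (F' \- H').
Proof.
move=> h1 h2 x Gx; have P := within_dom_proper Gx.
have -> : diff_quot (F \- H) x = diff_quot F x \- diff_quot H x.
  by apply/funext => y; rewrite /diff_quot /=; lra.
exact: cvgB (h1 x Gx) (h2 x Gx).
Qed.

Lemma hasder_cvg F F' x : hasder F F' -> G x -> F y @[y --> within G (nbhs x)] --> F x.
Proof.
move=> /hasderP h Gx; apply/cvgrPdist_lt => e e0; rewrite near_withinE.
have H1 := h x Gx 1 ltr01; set M := `|F' x| + 1.
have M0 : 0 < M by rewrite ltr_wpDl.
near=> y => Gy; have [->|yx] := eqVneq y x; first by rewrite subrr normr0.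
have q1 : `|F' x - diff_quot F x y| < 1 by move: Gy yx; near: y; apply: filterS H1 => y h1 ? ?; exact: h1.
have qM : `|diff_quot F x y| <= M.
  rewrite -[diff_quot _ _ _](subKr (F' x)); apply: le_trans (ler_normB _ _) _.
  by rewrite lerD2l ltW.
have yx0 : y - x != 0 by rewrite subr_eq0.
have -> : F x - F y = - ((y - x) * diff_quot F x y) by rewrite /diff_quot mulVKf // opprB.
rewrite normrN normrM; apply: (@le_lt_trans _ _ (`|y - x| * M)); first by rewrite ler_wpM2l.
rewrite -ltr_pdivlMr // distrC.
near: y; apply: cvgr_dist_lt; [exact: cvg_id|exact: divr_gt0].
Unshelve. all: by end_near. Qed.

Lemma hasder_within F F' x y : hasder F F' -> G x -> {within `[x, y], continuous F}.
Proof.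
move=> h Gx; apply/subspace_continuousP => z zxy.
move=> P /(hasder_cvg h (dom_itv Gx zxy)); rewrite /fmap /nbhs /within /=.
by apply: filterS => w Pw /(dom_itv Gx); exact: Pw.
Qed.

(** To the right of a point of [G], the set [G] is a neighbourhood, so the relative derivative is
    the ordinary one. *)
Lemma hasder_is_derive F F' x y : hasder F F' -> G x -> x < y -> is_derive y 1 F (F' y).
Proof.
move=> /hasderP h Gx xy; have Gy : G y by exact: dom_up Gx (ltW xy).
suff H : h^-1 *: ((F \o shift y) (h *: 1) - F y) @[h --> 0^'] --> F' y.
  by apply: DeriveDef; [apply/cvg_ex; exists (F' y)|apply: cvg_lim].
apply/cvgrPdist_lt => e e0; rewrite near_withinE.
have hy : \forall z \near y, G z /\ (z != y -> G z -> `|F' y - diff_quot F y z| < e).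
  exact: (filterI (nbhs_dom Gx xy) (h y Gy e e0)).
move: hy; rewrite (near_shift 0) subr0 /=.
apply: filterS => z /= [Gz H] z0; rewrite /GRing.scale /= mulr1.
have := H; rewrite /diff_quot addrK; apply => //.
by rewrite -subr_eq0 addrK.
Qed.

Lemma hasder_MVT F F' x y : hasder F F' -> G x -> x < y ->
  exists2 c, x <= c <= y & F y - F x = F' c * (y - x).
Proof.
move=> h Gx xy.
have [|c cxy E] := @MVT R F F' x y xy _ (hasder_within h Gx).
  by move=> z; rewrite in_itv /= => /andP[xz _]; exact: hasder_is_derive h Gx xz.
by exists c => //; move: cxy; rewrite in_itv /= => /andP[? ?]; rewrite !ltW.
Qed.

(** [F j] stands for the j-th derivative. Passing to the family [F j - F j (. + t)] lowers the order
    by one; the increment of [F q] that remains falls to the mean value theorem. The sign comes from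
    subtracting the later value. *)
Lemma fwd_diff_MVT q (F : nat -> R -> R) t y :
  (forall j, (j < q)%N -> hasder (F j) (F j.+1)) -> G y -> 0 < t ->
  exists2 c, y <= c <= y + q%:R * t & fwd_diff q t (F 0%N) y = (- t) ^+ q * F q c.
Proof.
elim: q F => [|q IH] F hF Gy t0.
  by exists y; rewrite ?fwd_diff0 ?mul1r // mul0r addr0 lexx.
have Gt : G t by apply: dom_nneg; exact: ltW.
have hB j : (j < q)%N -> hasder (F j \- fun z => F j (z + t)) (F j.+1 \- fun z => F j.+1 (z + t)).
  by move=> jq; apply: hasderB; [|apply: hasder_shift => //]; apply: hF; exact: ltnW.
have [c /andP[yc cq] E] := IH (fun j => F j \- fun z => F j (z + t)) hB Gy t0.
have Gc : G c := dom_up Gy yc.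
have [|d /andP[cd dc] E'] := @hasder_MVT (F q) (F q.+1) c (c + t) (hF _ (ltnSn q)) Gc.
  by rewrite ltrDl.
exists d; first by rewrite (le_trans yc cd) /= -natr1; lra.
rewrite fwd_diffSr E /= exprSr.
have -> : F q c - F q (c + t) = - (F q (c + t) - F q c) by rewrite opprB.
by rewrite E'; lra.
Qed.

End RelativeCalculus.

(** * Essential bounds and pointwise values *)

Section EssentialSupremum.
Context {R : realType}.
Local Notation mu := (@lebesgue_measure R).
Implicit Types (f : R -> R) (G : set R).

Lemma ae_sub (P Q : R -> Prop) : (forall x, P x -> Q x) ->
  {ae mu, forall x, P x} -> {ae mu, forall x, Q x}.
Proof.
move=> PQ [A [mA A0 PA]]; exists A; split => // x nQ.
by apply: (PA x) => /PQ.
Qed.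

Lemma ae_dense (P : R -> Prop) (x y : R) : {ae mu, forall z, P z} -> x < y ->
  exists2 z, x < z < y & P z.
Proof.
move=> [A [mA A0 PA]] xy; apply: contrapT => h.
have : (mu `]x, y[%classic <= mu A)%E.
  apply: le_measure; rewrite ?inE //.
  move=> z /=; rewrite in_itv /= => xzy; have [Pz|nPz] := pselect (P z); last exact: (PA z).
  by exfalso; apply: h; exists z.
by rewrite A0 lebesgue_measure_itv /= lte_fin xy lee_fin leNgt subr_gt0 xy.
Qed.

Lemma Linf_normE G f : Linf_norm G f = ess_sup mu (abse \o (EFin \o (f \_ G))).
Proof.
rewrite /Linf_norm unlock ifT //.
have : (0 < mu `]0%R, 1%R[%classic)%E.
  by rewrite lebesgue_measure_itv /= lte_fin ltr01 sube0 lte_fin.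
by move=> /lt_le_trans; apply; apply: le_measure; rewrite ?inE //; exact: measurable_itv.
Qed.

Lemma Linf_norm_ge0 G f : (0 <= Linf_norm G f)%E.
Proof. exact: Lnorm_ge0. Qed.

Lemma Linf_norm_ae G f : {ae mu, forall x, G x -> (`|f x|%:E <= Linf_norm G f)%E}.
Proof.
have := ess_sup_ge mu (abse \o (EFin \o (f \_ G))).
rewrite -Linf_normE; apply: ae_sub => x /= + Gx.
by rewrite patchE mem_set.
Qed.

Lemma Linf_norm_le G f (M : \bar R) : (0 <= M)%E ->
  (forall x, G x -> (`|f x|%:E <= M)%E) -> (Linf_norm G f <= M)%E.
Proof.
move=> M0 H; rewrite Linf_normE; apply/ess_supP; apply: nearW => x /=.
rewrite patchE; case: ifPn => [/set_mem/H//|_].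
by rewrite normr0.
Qed.

(** By right-continuity a value above [M] would persist on some []x, x + d[], which no null set
    contains. Only points to the right are used, as [x] may be the endpoint 0. *)
Lemma Linf_norm_right_continuous G f x (M : R) :
  (forall y, x < y -> G y) -> (Linf_norm G f <= M%:E)%E ->
  f y @[y --> x^'+] --> f x -> `|f x| <= M.
Proof.
move=> Gx fM cf; rewrite leNgt; apply/negP => Mf.
have e0 : 0 < `|f x| - M by rewrite subr_gt0.
have /cvgrPdist_lt/(_ _ e0) := cf; rewrite near_withinE => /nbhs_ballP[d /= d0 H].
have xd : x < x + d by rewrite ltrDl.
have [z /andP[xz zd] Hz] := ae_dense (Linf_norm_ae G f) xd.
have := le_trans (Hz (Gx _ xz)) fM; rewrite lee_fin => fzM.
have : `|f x - f z| < `|f x| - M.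
  by apply: H => //; rewrite /ball /= distrC gtr0_norm; lra.
by have := ler_distD 0 (f x) (f z); have := lerB_dist (f x) (f z); lra.
Qed.

End EssentialSupremum.

(** * Translates of functions in [Lr_space] *)

Section Lr.
Context {R : realType}.
Local Notation mu := (@lebesgue_measure R).
Variable G : set R.
Hypothesis hG : G = `[0, +oo[%classic \/ G = [set: R].
Variables (E : set (R -> R)) (N : (R -> R) -> R) (r : nat).
Hypotheses (hE : ideal_lattice G E N) (hs : semi_shift_invariant G E N).
Hypothesis r0 : (0 < r)%N.
Implicit Types (f F H : R -> R) (x y t : R).

Lemma Lr_hasder f j : Lr_space G r E f -> (j < r.-1)%N ->
  hasder G (deriven_on G j f) (deriven_on G j.+1 f).
Proof.
by move=> [_ _ h _ _] jr; apply: derivable_on_hasder => // x; exact: h.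
Qed.

(* y = 0 is excluded: for G = [0, +oo[ the derivative of H at 0 is one-sided,
   while that of F at x > 0 is two-sided and need not exist. *)
Lemma derive_on_shift F H x y : G x -> G y -> y != 0 ->
  {in G, H =1 fun z => F (z + x)} -> derive_on G H y = derive_on G F (y + x).
Proof.
move=> Gx Gy y0 HF; rewrite /derive_on; congr (lim _).
have nG := nbhs_dom_neq0 hG Gy y0.
have nGx : nbhs (y + x) G.
  have [xE|x0] := eqVneq x 0; first by rewrite xE addr0.
  have [yx0|yx0] := eqVneq (y + x) 0; last by apply: nbhs_dom_neq0 => //; exact: domD.
  case: (hG) => GE; last by rewrite GE; exact: filterT.
  by move: Gx Gy; rewrite GE /= !in_itv /= !andbT => ? ?; move/eqP: y0; lra.
have E1 z : G z -> diff_quot H y z = diff_quot F (y + x) (z + x).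
  move=> Gz; rewrite /diff_quot !HF ?inE //; congr (_^-1 * _); lra.
have W (K : R -> R) w (P : set R) : (diff_quot K w @ within G w^') P =
    nbhs w (fun z => z != w -> G z -> P (diff_quot K w z)) by [].
apply/funext => P; apply/propext; rewrite !W.
have -> : nbhs (y + x) = fun Q : set R => nbhs y (fun z => Q (z + x)).
  apply/funext => Q; apply/propext.
  have := @near_shift R _ y (y + x) Q.
  by rewrite /prop_near1 /= [y + x - y]addrC addKr /= => ->.
split=> K.
  have := @filterI _ _ (nbhs_filter y) _ _ nG K; apply: filterS => z [Gz h] zx _.
  by rewrite -E1 //; apply: h => //; apply: contra zx => /eqP ->.
have := @filterI _ _ (nbhs_filter y) _ _ nG K; apply: filterS => z [Gz h] zy _.
by rewrite E1 //; apply: h; [rewrite (inj_eq (addIr _))|exact: domD].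
Qed.

(** Up to order [r - 1] the derivatives of [f] exist at every point of [G], so the one-sided limit
    of the translate at 0 agrees with them; at order [r] this may fail. *)
Lemma deriven_on_shift f x j y : Lr_space G r E f -> (j <= r.-1)%N -> G x -> G y ->
  deriven_on G j (fun z => f (z + x)) y = deriven_on G j f (y + x).
Proof.
move=> Lf + Gx; elim: j y => [//|j IH] y jr Gy.
have h := hasder_shift hG Gx (Lr_hasder Lf jr).
apply: (hasder_derive_on hG (F' := fun z => deriven_on G j.+1 f (z + x))) => //.
apply: hasder_ext h => // z; rewrite inE => Gz.
by rewrite -IH //; exact: ltnW.
Qed.

Lemma deriven_on_shift_ae f x : Lr_space G r E f -> G x ->
  {ae mu, forall y, G y ->
    deriven_on G r (fun z => f (z + x)) y = deriven_on G r f (y + x)}.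
Proof.
move=> Lf Gx; exists [set 0]; split; first exact: measurable_set1.
  exact: lebesgue_measure_set1.
move=> y /=; apply: contra_notP => /eqP y0 Gy.
rewrite -(prednK r0) /deriven_on !iterS; apply: derive_on_shift => // z.
by rewrite inE => Gz; exact: deriven_on_shift.
Qed.

(** The r-th derivative of the translate and the translate of [f^(r)] agree on [G] away from 0. The
    ideal property carries membership and norm across; the measurability it asks for is obtained by
    splitting [G] at 0. *)
Lemma Lr_deriven_shift_E f x : Lr_space G r E f -> G x ->
  E (deriven_on G r (fun z => f (z + x))) /\
  N (deriven_on G r (fun z => f (z + x))) <= N (deriven_on G r f).
Proof.
move=> Lf Gx; have [_ _ _ _ Ef] := Lf.
have [Es NT NP] := hs Ef Gx.
have NN : N (fun y => deriven_on G r f (y + x)) <= N (deriven_on G r f).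
  by case: (hG) => [/NP//|/NT ->].
set g := (fun y => _) in Es NN.
set g' := deriven_on G r _.
have ms : measurable_fun G g'.
  have mGg := il_measurable hE Es.
  have E0 z : G z -> z != 0 -> g' z = g z.
    move=> Gz z0; rewrite /g' /g -(prednK r0) /deriven_on !iterS.
    apply: derive_on_shift => // w; rewrite inE => Gw; exact: deriven_on_shift.
  have GU : G = [set 0] `|` (G `\ 0).
    apply/seteqP; split => z; first by move=> Gz; have [->|/eqP z0] := eqVneq z 0; [left|right].
    by case=> [->|[]//]; exact: dom0.
  rewrite {1}GU; apply/measurable_funU; first exact: measurable_set1.
    by apply: measurableD; [exact: measurable_dom|exact: measurable_set1].
  split; first exact: measurable_fun_set1.
  apply: (eq_measurable_fun g) => [z|].
    by rewrite inE => -[Gz /eqP z0]; rewrite E0.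
  by apply: measurable_funS mGg => //; exact: measurable_dom.
have [|Eg' Ng'] := il_ideal hE Es ms; last by split => //; exact: le_trans NN.
have := deriven_on_shift_ae Lf Gx; apply: ae_sub => y h /h.
by rewrite /g' => ->.
Qed.

Lemma abs_continuous_within F x y : loc_abs_continuous G F -> G x ->
  {within `[x, y], continuous F}.
Proof.
move=> acF Gx; apply/subspace_continuousP => z zxy.
apply/cvgrPdist_lt => e e0; rewrite near_withinE.
have aF : abs_continuous x y F by apply: acF; exact: dom_itv.
have [d d0 Hd] := abs_continuous_dist aF e0.
near=> w => wxy.
have zw : `|z - w| < d by near: w; apply: cvgr_dist_lt => //; exact: cvg_id.
move: zxy wxy zw; rewrite /= !in_itv /= => /andP[xz zy] /andP[xw wy].
have [zw|/ltW wz] := leP z w => h.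
  by rewrite distrC; apply: Hd => //; rewrite -[w - z]ger0_norm ?subr_ge0 // distrC.
by apply: Hd => //; rewrite -[z - w]ger0_norm ?subr_ge0.
Unshelve. all: by end_near. Qed.

Lemma Lr_within f j x y : Lr_space G r E f -> (j <= r.-1)%N -> G x ->
  {within `[x, y], continuous (deriven_on G j f)}.
Proof.
move=> Lf; rewrite leq_eqVlt => /predU1P[->|jr] Gx.
  by apply: abs_continuous_within => //; case: Lf.
by apply: hasder_within Gx => //; exact: Lr_hasder.
Qed.

Lemma Lr_bounded f j x y : Lr_space G r E f -> (j <= r.-1)%N -> G x -> x <= y ->
  exists M : R, forall z, x <= z <= y -> `|deriven_on G j f z| <= M.
Proof.
move=> Lf jr Gx xy.
have [|c _ Hc] := @EVT_max R (fun z => `|deriven_on G j f z|) _ _ xy.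
  move=> z; apply: cvg_norm; exact: (Lr_within (y := y) Lf jr Gx).
by exists `|deriven_on G j f c| => z xzy; apply: Hc; rewrite in_itv.
Qed.

Lemma Lr_right_continuous f x : Lr_space G r E f -> G x -> f y @[y --> x^'+] --> f x.
Proof.
move=> Lf Gx; have x1 : x < x + 1 by rewrite ltrDl.
by have /(continuous_within_itvP _ x1)[] := Lr_within (j := 0) (y := x + 1) Lf (leq0n _) Gx.
Qed.

Lemma Lr_le_Linf f x : Lr_space G r E f -> G x -> `|f x| <= fine (Linf_norm G f).
Proof.
move=> Lf Gx; apply: (Linf_norm_right_continuous (G := G)) (Lr_right_continuous Lf Gx).
  by move=> y /ltW; exact: dom_up.
rewrite fineK //; case: Lf => _ h _ _ _.
by rewrite ge0_fin_numE // Linf_norm_ge0.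
Qed.

Lemma measurable_shift f x : measurable_fun G f -> G x -> measurable_fun G (fun z => f (z + x)).
Proof.
move=> mf Gx; apply: (@measurable_comp _ _ _ _ _ _ G f) => //; first exact: measurable_dom.
  by move=> _ [z Gz <-]; exact: domD.
by apply: measurable_funD.
Qed.

Lemma Lr_shift f x : Lr_space G r E f -> G x -> Lr_space G r E (fun z => f (z + x)).
Proof.
move=> Lf Gx; have [mf lf df af Ef] := Lf; split.
- exact: measurable_shift.
- apply: le_lt_trans (ltry (fine (Linf_norm G f))).
  apply: Linf_norm_le => [|z Gz]; first by rewrite lee_fin fine_ge0 // Linf_norm_ge0.
  by rewrite lee_fin; apply: Lr_le_Linf => //; exact: domD.
- move=> j y jr Gy; have h := hasder_shift hG Gx (Lr_hasder Lf jr).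
  have h' : hasder G (deriven_on G j (fun z => f (z + x))) (fun z => deriven_on G j.+1 f (z + x)).
    apply: hasder_ext h => // z; rewrite inE => Gz.
    by rewrite -deriven_on_shift //; exact: ltnW.
  exact: hasder_derivable h' Gy.
- move=> a b abG e e0.
  have [d d0 Hd] : exists2 d : R, 0 < d & forall s : seq (R * R),
      (forall p, p \in s -> [/\ a + x <= p.1, p.1 <= p.2 & p.2 <= b + x]) ->
      pairwise (fun p q => (p.2 <= q.1) || (q.2 <= p.1)) s ->
      \sum_(p <- s) (p.2 - p.1) < d ->
      \sum_(p <- s) `|deriven_on G r.-1 f p.2 - deriven_on G r.-1 f p.1| < e.
    apply: (af (a + x) (b + x)) => // z /=; rewrite in_itv /= => /andP[az zb].
    rewrite -[z](subrK x); apply: domD => //; apply: abG; rewrite /= in_itv /=; apply/andP; split; lra.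
  exists d => // s s1 s2 sd.
  have -> : \sum_(p <- s) `|deriven_on G r.-1 (fun z => f (z + x)) p.2 -
        deriven_on G r.-1 (fun z => f (z + x)) p.1| =
      \sum_(p <- s) `|deriven_on G r.-1 f (p.2 + x) - deriven_on G r.-1 f (p.1 + x)|.
    apply: eq_big_seq => p /s1[ap pp pb].
    rewrite !deriven_on_shift //; apply: abG; rewrite /= in_itv /=.
      by rewrite ap (le_trans pp pb).
    by rewrite pb (le_trans ap pp).
  have := Hd [seq (p.1 + x, p.2 + x) | p <- s]; rewrite !big_map /=.
  have -> : \sum_(p <- s) (p.2 + x - (p.1 + x)) = \sum_(p <- s) (p.2 - p.1).
    by apply: eq_bigr => p _; lra.
  apply => //.
    by move=> _ /mapP[p /s1[ap pp pb] ->] /=; rewrite !lerD2r.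
  by rewrite pairwise_map; apply: sub_pairwise s2 => p q /=; rewrite !lerD2r.
- by case: (Lr_deriven_shift_E Lf Gx).
Qed.

End Lr.

(** * Stieltjes integrals, the associated norm, and the upper bound *)

Section Stieltjes.
Context {R : realType}.
Implicit Types (f Omega : R -> R) (a b : R) (G : set R).

Lemma itv_partition_mesh (d a b : R) : 0 < d -> a <= b ->
  exists2 s, itv_partition a b s & forall i, (i < size s)%N ->
    nth b (a :: s) i <= nth b (a :: s) i.+1 /\
    nth b (a :: s) i.+1 - nth b (a :: s) i < d.
Proof.
move=> d0 ab; have [N bN] : exists N : nat, b - a <= N%:R * (d / 2).
  exists (Num.truncn (2 * (b - a) / d)).+1.
  have : 2 * (b - a) / d <= (Num.truncn (2 * (b - a) / d)).+1%:R by apply/ltW/truncnS_gt.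
  by rewrite ler_pdivrMr // => ?; lra.
elim: N a ab bN => [|N IH] a ab bN.
  exists [::] => //; split => //=; rewrite eq_le ab -subr_le0.
  by rewrite (le_trans bN) // mul0r.
have [bd|bd] := leP (b - a) (d / 2).
  have [->|/eqP ab'] := pselect (a = b); first by exists [::] => //; split => /=.
  exists [:: b]; first by apply: itv_partition1; rewrite lt_neqAle ab'.
  by case=> //= _; split => //; lra.
have ad : a + d / 2 <= b by lra.
have [|s sp Hs] := IH _ ad; first by move: bN; rewrite -natr1 => ?; lra.
exists (a + d / 2 :: s).
  case: sp => h1 h2; split => //=; rewrite h1 andbT ltrDl; lra.
by case=> [_|i /Hs//] /=; split; lra.
Qed.

Lemma RS_sum_le a b f Omega s t (M : R) : 
  (forall i, (i < size s)%N -> `|f (nth b t i)| <= M) ->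
  `|RS_sum a b f Omega s t| <= M * variation a b Omega s.
Proof.
move=> H; rewrite /RS_sum /variation mulr_sumr.
apply: le_trans (ler_norm_sum _ _ _) _; rewrite !big_nat; apply: ler_sum => i /andP[_ si] /=.
by rewrite normrM ler_wpM2r // H.
Qed.

Lemma TV_on_ge0 G Omega : G 0 -> (0 <= TV_on G Omega)%E.
Proof.
move=> dom0; apply: (@le_trans _ _ (total_variation 0 0 Omega)).
  by rewrite total_variationxx.
by apply: ereal_sup_ubound; exists (0, 0).
Qed.

Lemma RS_integral_le G a b f Omega J (M V : R) : G a -> G b -> a <= b ->
  (forall z, a <= z -> z <= b -> `|f z| <= M) ->
  (TV_on G Omega <= V%:E)%E -> is_RS_integral a b f Omega J -> `|J| <= M * V.
Proof.
move=> Ga Gb ab fM TVV HJ.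
have M0 : 0 <= M := le_trans (normr_ge0 _) (fM _ (lexx a) ab).
apply/ler_addgt0Pr => e e0; have [d d0 Hd] := HJ e e0.
have [s sp Hs] := itv_partition_mesh d0 ab.
have hJ : `|RS_sum a b f Omega s s - J| < e.
  by apply: Hd => // i si; have [h1 h2] := Hs i si; split.
have h1 : `|RS_sum a b f Omega s s| <= M * variation a b Omega s.
  apply: RS_sum_le => i si; apply: fM.
    by apply: (@itv_partition_nth_ge _ _ a b s i.+1).
  by apply: (@itv_partition_nth_le _ _ a b s i.+1).
have h2 : variation a b Omega s <= V.
  rewrite -lee_fin; apply: le_trans TVV; apply: (@le_trans _ _ (total_variation a b Omega)).
    by apply: ereal_sup_ubound; exists (variation a b Omega s) => //; exact: variations_variation.
  by apply: ereal_sup_ubound; exists (a, b).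
have h3 : M * variation a b Omega s <= M * V by exact: ler_wpM2l.
rewrite -[J](subKr (RS_sum a b f Omega s s)); apply: le_trans (ler_normB _ _) _.
  by apply: lerD; [exact: le_trans h1 h3|exact: ltW].
Qed.

(** Riemann-Stieltjes sums obey the bound, which passes to the limit over partitions and then over
    intervals. When no value exists, [stieltjes] is 0 and the bound is trivial. *)
Lemma stieltjes_le G f Omega (M V : R) : (forall x y, G x -> x <= y -> G y) ->
  0 <= M -> (forall z, G z -> `|f z| <= M) -> 0 <= V ->
  (TV_on G Omega <= V%:E)%E -> `|stieltjes G f Omega| <= M * V.
Proof.
move=> Gup M0 fM V0 TVV; rewrite /stieltjes.
case: xgetP => [I _ HI|_]; last by rewrite normr0 mulr_ge0.
apply/ler_addgt0Pr => e e0; have [a0 [b0 [Ga Gb ab H]]] := HI e e0.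
have [J HJ JI] := H a0 b0 Ga Gb (lexx _) (lexx _).
have h := RS_integral_le Ga Gb ab (fun z az _ => fM z (Gup _ _ Ga az)) TVV HJ.
rewrite -[I](subKr J); apply: le_trans (ler_normB _ _) _.
by apply: lerD => //; exact: ltW.
Qed.

End Stieltjes.

Lemma measurable_sgr {R : realType} : measurable_fun [set: R] (@Num.sg R).
Proof.
have -> : @Num.sg R = \1_(`]0, +oo[) \- \1_(`]-oo, 0[).
  apply/funext => x /=; rewrite !indicE !mem_setE !in_itv /= andbT.
  by case: sgrP => _; rewrite ?subr0 ?subrr ?sub0r.
by apply: measurable_funB; apply: measurable_indic; exact: measurable_itv.
Qed.

(** * Duality between the lattice and its associated space *)

Section AssociatedNorm.
Context {R : realType}.
Local Notation mu := (@lebesgue_measure R).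
Variables (G : set R) (E : set (R -> R)) (N : (R -> R) -> R).
Hypotheses (mG : measurable G) (hE : ideal_lattice G E N).
Implicit Types (e psi : R -> R).

Lemma ideal_zero_norm : N (cst 0) = 0.
Proof.
have := il_normZ hE 0 (il_zero hE); rewrite normr0 mul0r.
by have -> : 0 \*o cst 0 = cst 0 :> (R -> R) by apply/funext => x /=; rewrite mul0r.
Qed.

Lemma assoc_norm_ge0 psi : (0 <= assoc_norm G E N psi)%E.
Proof.
apply: ereal_sup_ubound; exists (cst 0).
  by split; [exact: (il_zero hE)|rewrite ideal_zero_norm].
by apply: integral0_eq => x _ /=; rewrite mul0r.
Qed.

(** Scaling [e] to norm 1 gives an admissible function. When [N e = 0] no scaling is possible, but
    [e] vanishes a.e. and both sides are 0, even if the associated norm is infinite. *)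
Lemma ge0_integral_le_assoc psi e : E e -> measurable_fun G psi ->
  (forall x, G x -> 0 <= e x * psi x) ->
  (\int[mu]_(x in G) (e x * psi x)%:E <= assoc_norm G E N psi * (N e)%:E)%E.
Proof.
move=> Ee mpsi e0; have me := il_measurable hE Ee.
have mep : measurable_fun G (fun x => e x * psi x) by exact: measurable_funM.
have := il_norm_ge0 hE Ee; rewrite le_eqVlt => /predU1P[/esym Ne0|Ne0].
  rewrite Ne0 mule0 (ae_eq_integral (cst 0%E)) ?integral_cst_0 //.
  - by rewrite integral0.
  - exact/measurable_EFinP.
  - have := il_norm_eq0 hE Ee Ne0; apply: ae_sub => x h Gx /=.
    by rewrite h // mul0r.
have -> : (\int[mu]_(x in G) (e x * psi x)%:E =
    (N e)%:E * \int[mu]_(x in G) (((N e)^-1 \*o e) x * psi x)%:E)%E.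
  rewrite -ge0_integralZl //.
  - by apply: eq_integral => x _; rewrite -EFinM mulrA /= mulVKf // gt_eqF.
  - apply/measurable_EFinP; apply: measurable_funM => //.
    exact: measurable_funM.
  - by move=> x Gx; rewrite lee_fin /= -mulrA mulr_ge0 ?e0 // invr_ge0 ltW.
  - by rewrite lee_fin ltW.
rewrite muleC lee_pmul2r //; apply: ereal_sup_ubound; exists ((N e)^-1 \*o e) => //.
split; first exact: (il_scale hE).
by rewrite (il_normZ hE) // gtr0_norm ?invr_gt0 // mulVf // gt_eqF.
Qed.

(** [|e| sgn psi] lies in [E] with norm at most [N e], and its product with [psi] is [|e psi|]. *)
Lemma abs_integral_le_assoc psi e : E e -> measurable_fun G psi ->
  (\int[mu]_(x in G) `|e x * psi x|%:E <= assoc_norm G E N psi * (N e)%:E)%E.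
Proof.
move=> Ee mpsi; pose e' x := `|e x| * Num.sg (psi x).
have me := il_measurable hE Ee.
have me' : measurable_fun G e'.
  apply: measurable_funM; first exact: measurableT_comp.
  by apply: measurableT_comp => //; exact: measurable_sgr.
have [|Ee' Ne'] := il_ideal hE Ee me'.
  apply: aeW => x _; rewrite /e' normrM normr_id normr_sg.
  by rewrite ler_piMr // lern1 leq_b1.
have e'E x : e' x * psi x = `|e x * psi x|.
  by rewrite /e' -mulrA -normrEsg normrM.
apply: (@le_trans _ _ (assoc_norm G E N psi * (N e')%:E)%E); last first.
  by apply: lee_wpmul2l; rewrite ?assoc_norm_ge0 ?lee_fin.
under eq_integral do rewrite -e'E.
by apply: ge0_integral_le_assoc => // x _; rewrite e'E.
Qed.

Lemma Rintegral_le_assoc psi e (A : R) : E e -> measurable_fun G psi ->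
  (assoc_norm G E N psi <= A%:E)%E ->
  `|\int[mu]_(x in G) (psi x * e x)| <= A * N e.
Proof.
move=> Ee mpsi AA; rewrite -lee_fin.
have me := il_measurable hE Ee.
apply: (@le_trans _ _ `|\int[mu]_(x in G) (psi x * e x)%:E|%E).
  (* An infinite integral has real value 0, so the comparison holds in that case too. *)
  by rewrite /Rintegral; case: (integral _ _ _) => [x||] /=; rewrite ?normr0 ?leey.
apply: le_trans (le_abse_integral _ _ _) _ => //.
  by apply/measurable_EFinP; exact: measurable_funM.
apply: (@le_trans _ _ (assoc_norm G E N psi * (N e)%:E)%E).
  apply: le_trans (abs_integral_le_assoc Ee mpsi).
  by under eq_integral do rewrite /= mulrC.
rewrite EFinM; apply: lee_wpmul2r => //.
by rewrite lee_fin (il_norm_ge0 hE).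
Qed.

End AssociatedNorm.

Section UpperBound.
Context {R : realType}.
Variables (G : set R) (r n : nat) (k : R) (E : set (R -> R)) (N : (R -> R) -> R).
Variable Omega : R -> R.
Hypotheses (hG : G = `[0, +oo[%classic \/ G = [set: R]) (r0 : (0 < r)%N).
Hypotheses (hE : ideal_lattice G E N) (hs : semi_shift_invariant G E N).
Hypotheses (hOmega : BV_L1 G Omega) (hker : assoc_space G E N (rem_ker G r k Omega)).
Hypothesis hrep : forall f, Lr_space G r E f ->
  marchaud k n f 0 - stieltjes G f Omega =
  (-1) ^+ r * \int[@lebesgue_measure R]_(x in G)
                 (rem_ker G r k Omega x * deriven_on G r f x).

Lemma TV_on_fineK : (fine (TV_on G Omega))%:E = TV_on G Omega.
Proof.
by rewrite fineK // ge0_fin_numE ?(TV_on_ge0 _ (dom0 hG)) //; case: hOmega.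
Qed.

Lemma Linf_norm_fineK f : Lr_space G r E f -> (fine (Linf_norm G f))%:E = Linf_norm G f.
Proof. by case=> _ h _ _ _; rewrite fineK // ge0_fin_numE // Linf_norm_ge0. Qed.

Lemma assoc_norm_fineK psi : assoc_space G E N psi ->
  (fine (assoc_norm G E N psi))%:E = assoc_norm G E N psi.
Proof. by case=> _ _ h; rewrite fineK // ge0_fin_numE // assoc_norm_ge0. Qed.

Lemma marchaud_shift f x : marchaud k n (fun z => f (z + x)) 0 = marchaud k n f x.
Proof.
rewrite /marchaud; congr (_ * _); apply: eq_Rintegral => t _.
by rewrite fwd_diff_shift add0r.
Qed.

Lemma marchaud_le f x : Lr_space G r E f -> G x ->
  `|marchaud k n f x| <= fine (TV_on G Omega) * fine (Linf_norm G f) +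
     fine (assoc_norm G E N (rem_ker G r k Omega)) * N (deriven_on G r f).
Proof.
move=> Lf Gx; have Ls := Lr_shift hG hE hs r0 Lf Gx.
have [Es Ns] := Lr_deriven_shift_E hG hE hs r0 Lf Gx.
have := hrep Ls; rewrite marchaud_shift => /eqP; rewrite subr_eq => /eqP ->.
apply: le_trans (ler_normD _ _) _; rewrite addrC; apply: lerD.
  rewrite mulrC; apply: stieltjes_le; rewrite ?TV_on_fineK //.
  - exact: dom_up.
  - by rewrite fine_ge0 // Linf_norm_ge0.
  - by move=> z Gz; apply: (Lr_le_Linf hG Lf); exact: domD.
  - by rewrite fine_ge0 // TV_on_ge0 //; exact: dom0.
rewrite normrM normrX normrN1 expr1n mul1r.
apply: (le_trans (Rintegral_le_assoc (A := fine (assoc_norm G E N (rem_ker G r k Omega)))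
  (measurable_dom hG) hE Es _ _)).
- by case: hker.
- by rewrite assoc_norm_fineK.
- by apply: ler_wpM2l => //; rewrite fine_ge0 // assoc_norm_ge0.
Qed.

Lemma Linf_marchaud_le f : Lr_space G r E f ->
  (Linf_norm G (marchaud k n f) <=
   TV_on G Omega * Linf_norm G f +
   assoc_norm G E N (rem_ker G r k Omega) * (N (deriven_on G r f))%:E)%E.
Proof.
move=> Lf; rewrite -TV_on_fineK -(Linf_norm_fineK Lf) -(assoc_norm_fineK hker).
rewrite -!EFinM -EFinD; apply: Linf_norm_le => [|x Gx]; rewrite lee_fin.
  by apply: le_trans (marchaud_le Lf (dom0 hG)).
exact: marchaud_le.
Qed.

End UpperBound.

(** * Power integrals and the Gamma function *)

Section PowerIntegrals.
Context {R : realType}.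
Local Notation mu := (@lebesgue_measure R).
Implicit Types (a b c s : R).

(** By monotone convergence; it carries bounds from the fundamental theorem on compact intervals
    over to improper integrals. *)
Lemma ge0_integral_bigcup_le (F : nat -> set R) (f : R -> \bar R) (B : \bar R) :
  {homo F : m n / (m <= n)%N >-> m `<=` n} -> (forall i, measurable (F i)) ->
  measurable_fun setT f -> (forall x, (0 <= f x)%E) ->
  (forall i, (\int[mu]_(x in F i) f x <= B)%E) ->
  (\int[mu]_(x in \bigcup_i F i) f x <= B)%E.
Proof.
move=> ndF mF mf f0 H.
have cv : (\int[mu]_(x in F i) f x @[i --> \oo] --> \int[mu]_(x in \bigcup_i F i) f x)%E.
  apply: ge0_nondecreasing_set_cvg_integral => //.
  - by move=> m n mn; apply/subsetPset; exact: ndF.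
  - by move=> i; exact: measurable_funTS.
rewrite -(cvg_lim _ cv) //; apply: lime_le; first by apply/cvg_ex; eexists; exact: cv.
by apply: nearW => i; exact: H.
Qed.

Lemma integral_powR_itv a b c : 0 < a -> a < b -> c + 1 != 0 ->
  (\int[mu]_(t in `[a, b]) (t `^ c)%:E = ((b `^ (c + 1) - a `^ (c + 1)) / (c + 1))%:E)%E.
Proof.
move=> a0 ab c1.
have D (x : R) : 0 < x -> is_derive x 1 (fun t : R => t `^ (c + 1) / (c + 1)) (x `^ c).
  move=> x0; have h : is_derive x 1 (@powR R ^~ (c + 1)) ((c + 1) * x `^ c).
    by have := is_derive1_powR (c + 1) x0; rewrite addrK.
  have -> : x `^ c = (c + 1)^-1 *: ((c + 1) * x `^ c) by rewrite /GRing.scale /= mulKf.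
  have -> : (fun t : R => t `^ (c + 1) / (c + 1)) = (c + 1)^-1 \*: (@powR R ^~ (c + 1)).
    by apply/funext => t; rewrite /= /GRing.scale /= mulrC.
  exact: is_deriveZ.
have C (f : R -> R) (x l : R) : is_derive x 1 f l -> {for x, continuous f}.
  by move=> h; apply: differentiable_continuous; apply/derivable1_diffP; case: h.
rewrite (continuous_FTC2 (F := fun t : R => t `^ (c + 1) / (c + 1))) //.
- by rewrite -EFinB mulrBl.
- apply: continuous_in_subspaceT => x; rewrite inE /= in_itv /= => /andP[ax _].
  by apply: C (is_derive1_powR c _); exact: lt_le_trans ax.
- split.
  + move=> x; rewrite in_itv /= => /andP[ax _].
    by have [] := D x (lt_trans a0 ax).
  + by apply: cvg_at_right_filter; exact: C (D a a0).
  + by apply: cvg_at_left_filter; exact: C (D b (lt_trans a0 ab)).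
- move=> x; rewrite in_itv /= => /andP[ax _].
  by have [_ <-] := D x (lt_trans a0 ax); rewrite derive1E.
Qed.

Lemma measurable_powR_EFin c : measurable_fun [set: R] (fun t : R => (t `^ c)%:E).
Proof. by apply/measurable_EFinP; exact: measurable_powR. Qed.

Lemma integral_powR_near0_le b c : 0 < b -> -1 < c ->
  (\int[mu]_(t in `]0%R, b[) (t `^ c)%:E <= (b `^ (c + 1) / (c + 1))%:E)%E.
Proof.
move=> b0 c1; have c10 : 0 < c + 1 by lra.
(* [m.+2] keeps the left end strictly below [b] already for [m = 0]. *)
pose F (m : nat) : set R := `[b / m.+2%:R, b]%classic.
apply: (@le_trans _ _ (\int[mu]_(t in \bigcup_m F m) (t `^ c)%:E)%E).
  apply: ge0_subset_integral => //.
  - by apply: bigcupT_measurable => m; exact: measurable_itv.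
  - by apply: measurable_funTS; exact: measurable_powR_EFin.
  - by move=> x _; rewrite lee_fin powR_ge0.
  - move=> x /=; rewrite in_itv /= => /andP[x0 xb].
    exists (Num.truncn (b / x)) => //; rewrite /F /= in_itv /= (ltW xb) andbT.
    rewrite ler_pdivrMr // mulrC -ler_pdivrMr //.
    apply: (@le_trans _ _ (Num.truncn (b / x)).+1%:R); first by apply/ltW/truncnS_gt.
    by rewrite ler_nat.
apply: ge0_integral_bigcup_le => //.
- move=> m n mn x; rewrite /F /= !in_itv /= => /andP[h ->]; rewrite andbT.
  apply: le_trans h; rewrite ler_pM2l // lef_pV2 ?posrE // ler_nat.
  by rewrite !ltnS.
- by move=> m; exact: measurable_itv.
- exact: measurable_powR_EFin.
- by move=> x; rewrite lee_fin powR_ge0.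
move=> m; have bm : 0 < b / m.+2%:R by rewrite divr_gt0.
rewrite integral_powR_itv ?gt_eqF //.
  by rewrite lee_fin ler_pM2r ?invr_gt0 // gerBl powR_ge0.
by rewrite ltr_pdivrMr // ltr_pMr // ltr1n.
Qed.

Lemma integral_powR_tail_le a c : 0 < a -> c < -1 ->
  (\int[mu]_(t in `]a, +oo[) (t `^ c)%:E <= (a `^ (c + 1) / - (c + 1))%:E)%E.
Proof.
move=> a0 c1; have c10 : 0 < - (c + 1) by lra.
pose F (m : nat) : set R := `[a, a + m.+1%:R]%classic.
apply: (@le_trans _ _ (\int[mu]_(t in \bigcup_m F m) (t `^ c)%:E)%E).
  apply: ge0_subset_integral => //.
  - by apply: bigcupT_measurable => m; exact: measurable_itv.
  - by apply: measurable_funTS; exact: measurable_powR_EFin.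
  - by move=> x _; rewrite lee_fin powR_ge0.
  - move=> x /=; rewrite in_itv /= andbT => ax.
    exists (Num.truncn (x - a)) => //; rewrite /F /= in_itv /= (ltW ax) /=.
    by rewrite -lerBlDl; apply/ltW/truncnS_gt.
apply: ge0_integral_bigcup_le => //.
- move=> m n mn x; rewrite /F /= !in_itv /= => /andP[-> h] /=.
  by apply: le_trans h _; rewrite lerD2l ler_nat ltnS.
- by move=> m; exact: measurable_itv.
- exact: measurable_powR_EFin.
- by move=> x; rewrite lee_fin powR_ge0.
move=> m; rewrite integral_powR_itv //; last 2 first.
- by rewrite ltrDl.
- by rewrite -oppr_eq0 gt_eqF.
rewrite lee_fin -[X in X <= _]opprK -mulrN -invrN -mulNr opprB.
by rewrite ler_pM2r ?invr_gt0 // gerBl powR_ge0.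
Qed.

(** With [m >= s]: [t ^ s <= t ^ m], and [exp t = exp (t / m) ^ m >= (t / m) ^ m]. *)
Lemma expR_ge_powR s (t : R) : 0 < s -> 1 <= t ->
  t `^ s <= ((Num.truncn s).+1%:R) ^+ (Num.truncn s).+1 * expR t.
Proof.
move=> s0 t1; set m := (Num.truncn s).+1.
have t0 : 0 <= t by lra.
have sm : s <= m%:R by apply/ltW/truncnS_gt.
apply: (@le_trans _ _ (t ^+ m)); first by rewrite -powR_mulrn // ler_powR.
have -> : expR t = expR (t / m%:R) ^+ m by rewrite -expRM_natr divfK ?pnatr_eq0.
rewrite -exprMn; apply: lerXn2r; rewrite ?nnegrE //.
rewrite -ler_pdivrMl //; apply: le_trans (expR_ge1Dx _).
by rewrite mulrC lerDr.
Qed.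

(** Finiteness comes first, since the real integral is 0 also when Euler's integral is infinite: the
    integrand is below [t ^ (s - 1)] near 0 and below a multiple of [t ^ (-2)] at infinity. A zero
    integral would then force the positive integrand to vanish a.e. *)
Lemma Gamma_int_neq0 s : 0 < s -> Gamma_int s != 0.
Proof.
move=> s0; pose f t := t `^ (s - 1) * expR (- t).
have f0 t : 0 <= f t by rewrite mulr_ge0 ?powR_ge0 ?expR_ge0.
have mf : measurable_fun setT (fun t => (f t)%:E).
  apply/measurable_EFinP; apply: measurable_funM; first exact: measurable_powR.
  by apply: measurableT_comp => //.
have fin : (\int[mu]_(t in `]0%R, +oo[) (f t)%:E < +oo)%E.
  set m := (Num.truncn (s + 1)).+1; set C := m%:R ^+ m : R.
  have C0 : 0 <= C by rewrite exprn_ge0.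
  have -> : `]0%R, +oo[%classic = (`]0%R, 2[ `|` `[2, +oo[)%classic :> set R.
    apply/seteqP; split => x /=; rewrite !in_itv /= !andbT.
      by move=> x0; case: (ltP x 2) => h; [left|right] => //; rewrite x0.
    by case=> [/andP[]//|]; lra.
  rewrite ge0_integral_setU //=; last 3 first.
    by apply: measurable_funTS; exact: mf.
    by move=> x _; rewrite lee_fin.
    by apply/disj_setPS => x [] /=; rewrite !in_itv /= andbT => /andP[_ h1] h2; lra.
  apply: lte_add_pinfty.
    apply: le_lt_trans (ltry (2 `^ (s - 1 + 1) / (s - 1 + 1))).
    apply: le_trans (integral_powR_near0_le _ _) => //; last by lra.
    apply: ge0_le_integral => //=.
    - by move=> x _; rewrite lee_fin.
    - exact: measurable_funTS.
    - by apply: measurable_funTS; exact: measurable_powR_EFin.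
    - move=> x; rewrite in_itv /= => /andP[x0 _]; rewrite lee_fin ler_piMr ?powR_ge0 //.
      by rewrite expR_le1; lra.
  apply: (@le_lt_trans _ _ (C%:E * \int[mu]_(t in `]1%R, +oo[) (t `^ (-2))%:E)%E).
    rewrite -ge0_integralZl //=; last 2 first.
    - by apply: measurable_funTS; exact: measurable_powR_EFin.
    - by move=> x _; rewrite lee_fin powR_ge0.
    apply: (@le_trans _ _ (\int[mu]_(t in `]1%R, +oo[) (f t)%:E)%E).
      apply: ge0_subset_integral => //=.
      + by apply: measurable_funTS.
      + by move=> x _; rewrite lee_fin.
      + by move=> x /=; rewrite !in_itv /= !andbT; lra.
    apply: ge0_le_integral => //=.
    - by move=> x _; rewrite lee_fin.
    - exact: measurable_funTS.
    - by apply: measurable_funTS; apply: measurable_funeM; exact: measurable_powR_EFin.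
    - move=> x; rewrite in_itv /= andbT => x1; rewrite -EFinM lee_fin.
      have x0 : x != 0 by rewrite gt_eqF //; lra.
      have -> : f x = x `^ (-2) * (x `^ (s + 1) * expR (- x)).
        rewrite /f mulrA -powRD ?x0 ?implybT //; congr (_ `^ _ * _); lra.
      rewrite mulrC ler_wpM2r ?powR_ge0 // expRN ler_pdivrMr ?expR_gt0 //.
      by apply: expR_ge_powR; lra.
  apply: lte_mul_pinfty => //; rewrite ?lee_fin //.
  apply: le_lt_trans (integral_powR_tail_le _ _) (ltry _); lra.
rewrite /Gamma_int -/(f _); apply/eqP => int0.
have I0 : (\int[mu]_(t in `]0%R, +oo[) `|(f t)%:E| = 0)%E.
  under eq_integral do rewrite gee0_abs ?lee_fin //.
  rewrite -[LHS]fineK; last by rewrite ge0_fin_numE // integral_ge0 // => x _; rewrite lee_fin.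
  by congr EFin.
have [|ae] := @ae_eq_integral_abs _ _ R mu _ (measurable_itv `]0%R, +oo[) (fun t => (f t)%:E).
  exact: measurable_funTS.
move=> _; have [x /andP[x0 _] /=] := ae_dense (ae I0) (@ltr01 R).
rewrite in_itv /= x0 => /(_ isT) [] /eqP.
by rewrite gt_eqF // mulr_gt0 ?powR_gt0 ?expR_gt0.
Qed.

End PowerIntegrals.

(** * One-sided continuity of the Marchaud derivative at 0 *)

Section UniformNearZero.
Context {R : realType}.
Local Notation mu := (@lebesgue_measure R).

Lemma dist_add_thirds (a b c d e : R) : `|a| <= e / 3 -> `|b| <= e / 3 ->
  `|c - d| <= e / 3 -> `|a + c - (b + d)| <= e.
Proof.
move=> h1 h2 h3; have -> : a + c - (b + d) = (a - b) + (c - d) by lra.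
by have := ler_normD (a - b) (c - d); have := ler_normB a b; lra.
Qed.

Lemma abs_Rintegral_le (D : set R) (h : R -> R) (e : R) : measurable D ->
  measurable_fun D h -> (\int[mu]_(t in D) `|h t|%:E <= e%:E)%E ->
  `|\int[mu]_(t in D) h t| <= e.
Proof.
move=> mD mh he; rewrite -lee_fin.
apply: (@le_trans _ _ `|\int[mu]_(t in D) (h t)%:E|%E).
  by rewrite /Rintegral; case: (integral _ _ _) => [x||] /=; rewrite ?normr0 ?leey.
apply: le_trans (le_abse_integral _ _ _) _ => //.
exact/measurable_EFinP.
Qed.

Lemma integrable_near0_tail (h : R -> R) (K c d B : R) : c < -1 -> 0 < d ->
  measurable_fun `](0 : R), +oo[ h ->
  (\int[mu]_(t in `]0%R, d]) `|h t|%:E <= B%:E)%E ->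
  (forall t, 0 < t -> `|h t| <= K * t `^ c) ->
  mu.-integrable `](0 : R), +oo[ (EFin \o h).
Proof.
move=> c1 d0 mh hB hK.
apply/integrableP; split; first exact/measurable_EFinP.
rewrite /= (_ : `](0 : R), +oo[%classic = (`]0%R, d] `|` `]d, +oo[)%classic :> set R); last first.
  apply/seteqP; split => x /=; rewrite !in_itv /= !andbT.
    by move=> x0; case: (leP x d) => h'; [left|right] => //; rewrite x0.
  by case=> [/andP[]//|]; lra.
have mabs (D : set R) : measurable D -> D `<=` `](0 : R), +oo[ ->
    measurable_fun D (fun t => `|h t|%:E).
  move=> mD DD; apply/measurable_EFinP; apply: measurableT_comp => //.
  by apply: measurable_funS mh => //; exact: measurable_itv.
have sub2 : `]d, +oo[%classic `<=` `](0 : R), +oo[%classic.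
  by move=> x /=; rewrite !in_itv /= !andbT; lra.
rewrite ge0_integral_setU //=; last 2 first.
- apply: mabs; first by apply: measurableU; exact: measurable_itv.
  by move=> x [|/sub2//] /=; rewrite !in_itv /= andbT => /andP[].
- by apply/disj_setPS => x [] /=; rewrite !in_itv /= andbT => /andP[_ h1] h2; lra.
apply: lte_add_pinfty; first exact: le_lt_trans hB (ltry _).
apply: (@le_lt_trans _ _ (`|K|%:E * \int[mu]_(t in `]d, +oo[) (t `^ c)%:E)%E).
  rewrite -ge0_integralZl //=; last 2 first.
  - by apply: measurable_funTS; exact: measurable_powR_EFin.
  - by move=> x _; rewrite lee_fin powR_ge0.
  apply: ge0_le_integral => //=.
  - by apply: mabs.
  - by apply: measurable_funTS; apply: measurable_funeM; exact: measurable_powR_EFin.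
  - move=> x /sub2 /=; rewrite in_itv /= andbT => x0; rewrite -EFinM lee_fin.
    by apply: le_trans (hK x x0) _; rewrite ler_wpM2r ?powR_ge0 ?ler_norm.
apply: lte_mul_pinfty => //.
exact: le_lt_trans (integral_powR_tail_le d0 c1) (ltry _).
Qed.

(** The majorant [K t ^ c] with [c < -1] is not integrable near 0. Uniform smallness on []0, d]]
    replaces it there, and dominated convergence is used on []d, +oo[] only. *)
Lemma Rintegral_cvg_uniform_near0 (h_ : nat -> R -> R) (h : R -> R) (K c : R) :
  c < -1 ->
  (forall j, measurable_fun `](0 : R), +oo[ (h_ j)) -> measurable_fun `](0 : R), +oo[ h ->
  (forall e : R, 0 < e -> exists2 d : R, 0 < d &
    (forall j, (\int[mu]_(t in `]0%R, d]) `|h_ j t|%:E <= e%:E)%E) /\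
    (\int[mu]_(t in `]0%R, d]) `|h t|%:E <= e%:E)%E) ->
  (forall j t, 0 < t -> `|h_ j t| <= K * t `^ c) ->
  (forall t, 0 < t -> `|h t| <= K * t `^ c) ->
  (forall t, 0 < t -> h_ j t @[j --> \oo] --> h t) ->
  \int[mu]_(t in `](0 : R), +oo[) h_ j t @[j --> \oo] --> \int[mu]_(t in `](0 : R), +oo[) h t.
Proof.
move=> c1 mh_ mh small dom_ dom pt.
apply/cvgrPdist_le => e e0; have e30 : 0 < e / 3 by rewrite divr_gt0.
have [d d0 [small_ small0]] := small _ e30.
have ih := integrable_near0_tail c1 d0 mh small0 dom.
have ih_ j := integrable_near0_tail c1 d0 (mh_ j) (small_ j) (dom_ j).
have DE : `](0 : R), +oo[%classic = (`]0%R, d] `|` `]d, +oo[)%classic :> set R.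
  apply/seteqP; split => x /=; rewrite !in_itv /= !andbT.
    by move=> x0; case: (leP x d) => h'; [left|right] => //; rewrite x0.
  by case=> [/andP[]//|]; lra.
have dis : [disjoint `]0%R, d]%classic & `]d, +oo[%classic].
  by apply/disj_setPS => x [] /=; rewrite !in_itv /= andbT => /andP[_ h1] h2; lra.
have sub1 : `]0%R, d]%classic `<=` `](0 : R), +oo[%classic.
  by rewrite DE; exact: subsetUl.
have sub2 : `]d, +oo[%classic `<=` `](0 : R), +oo[%classic.
  by rewrite DE; exact: subsetUr.
have S g : mu.-integrable `](0 : R), +oo[ (EFin \o g) -> \int[mu]_(t in `](0 : R), +oo[) g t =
    \int[mu]_(t in `]0, d]) g t + \int[mu]_(t in `]d, +oo[) g t.
  by move=> ig; rewrite DE Rintegral_setU -?DE //; exact: measurable_itv.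
have mS (D : set R) (g : R -> R) : measurable D -> D `<=` `](0 : R), +oo[ ->
    measurable_fun `](0 : R), +oo[ g -> measurable_fun D g.
  by move=> mD DD mg; apply: measurable_funS mg => //; exact: measurable_itv.
have cv : \int[mu]_(t in `]d, +oo[) h_ j t @[j --> \oo] --> \int[mu]_(t in `]d, +oo[) h t.
  have [] := @dominated_convergence _ _ R mu `]d, +oo[%classic (measurable_itv _)
    (fun j t => (h_ j t)%:E) (fun t => (h t)%:E) (fun t => (K * t `^ c)%:E).
  - by move=> j; apply/measurable_EFinP; apply: mS (mh_ j).
  - by apply/measurable_EFinP; apply: mS mh.
  - apply: aeW => t /sub2 /=; rewrite in_itv /= andbT => t0.
    by apply/fine_cvgP; split; [exact: nearW|exact: pt].
  - apply/integrableP; split.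
      by apply: measurable_funTS; apply/measurable_EFinP; apply: measurable_funM => //; exact: measurable_powR.
    under eq_integral do rewrite abse_EFin normrM (ger0_norm (powR_ge0 _ _)) EFinM.
    rewrite ge0_integralZl //=; last 2 first.
    - by apply: measurable_funTS; exact: measurable_powR_EFin.
    - by move=> x _; rewrite lee_fin powR_ge0.
    apply: lte_mul_pinfty => //.
    exact: le_lt_trans (integral_powR_tail_le d0 c1) (ltry _).
  - apply: aeW => t j /sub2 /=; rewrite in_itv /= andbT => t0.
    by rewrite lee_fin; exact: dom_.
  move=> i0 _ cv; apply: fine_cvg; rewrite fineK; first exact: cv.
  exact: integrable_fin_num i0.
near=> j.
have h1 : `|\int[mu]_(t in `]0, d]) h t| <= e / 3.
  by apply: abs_Rintegral_le small0 => //; apply: mS mh.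
have h2 : `|\int[mu]_(t in `]0, d]) h_ j t| <= e / 3.
  by apply: abs_Rintegral_le (small_ j) => //; apply: mS (mh_ j).
have h3 : `|\int[mu]_(t in `]d, +oo[) h t - \int[mu]_(t in `]d, +oo[) h_ j t| <= e / 3.
  by near: j; move/cvgrPdist_le : cv; apply.
rewrite (S h ih) (S _ (ih_ j)).
exact: dist_add_thirds.
Unshelve. all: by end_near. Qed.

End UniformNearZero.

(** * Exchange of integrals for the singular estimate *)

Section Tonelli.
Context {R : realType}.
Local Notation mu := (@lebesgue_measure R).

Lemma measurable_comp_fst (F : R -> R) :
  measurable_fun setT F -> measurable_fun setT (fun z : R * R => F z.1).
Proof.
move=> mF; apply: (@measurableT_comp _ _ _ _ _ _ F setT (fun z : R * R => z.1)) => //.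
exact: measurable_fst.
Qed.

Lemma measurable_comp_snd (F : R -> R) :
  measurable_fun setT F -> measurable_fun setT (fun z : R * R => F z.2).
Proof.
move=> mF; apply: (@measurableT_comp _ _ _ _ _ _ F setT (fun z : R * R => z.2)) => //.
exact: measurable_snd.
Qed.

(** Tonelli on the region [0 < t <= d], [0 < u < a t]: for fixed [u], the range []u / a, d]] of [t]
    is enlarged to []u / a, +oo[], where [t ^ c] has integral at most
    [(u / a) ^ (c + 1) / - (c + 1)]. *)
Lemma integral_powR_iterated_le (g : R -> R) (a c d : R) :
  measurable_fun setT g -> 0 < a -> c < -1 -> 0 < d ->
  (\int[mu]_(t in `]0%R, d]) ((t `^ c)%:E * \int[mu]_(u in `]0%R, (a * t)%R[) `|g u|%:E) <=
   (a `^ (- (c + 1)) / - (c + 1))%:E *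
     \int[mu]_(u in `]0%R, (a * d)%R[) `|g u * u `^ (c + 1)|%:E)%E.
Proof.
move=> mg a0 c1 d0; have c10 : 0 < - (c + 1) by lra.
(* Indicator of the region, written through [a * t - u] so that joint measurability is immediate. *)
pose J (t u : R) : R := \1_(`]0, d]%classic : set R) t *
  (\1_(`]0, +oo[%classic : set R) u * \1_(`]0, +oo[%classic : set R) (a * t - u)).
pose Phi (z : R * R) : \bar R := (z.1 `^ c * `|g z.2| * J z.1 z.2)%:E.
have Phi0 z : (0 <= Phi z)%E by rewrite lee_fin mulr_ge0 // mulr_ge0 // powR_ge0.
have mpos : measurable (`]0, +oo[%classic : set R) by exact: measurable_itv.
have mPhi : measurable_fun setT Phi.
  apply/measurable_EFinP; apply: measurable_funM; first apply: measurable_funM.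
  - by apply: (measurable_comp_fst (F := @powR R ^~ c)); exact: measurable_powR.
  - apply: (measurable_comp_snd (F := fun u => `|g u|)); exact: measurableT_comp.
  - apply: measurable_funM.
      by apply: (measurable_comp_fst (F := \1_(`]0, d]%classic : set R))); exact: measurable_indic.
    apply: measurable_funM; first by apply: (measurable_comp_snd (F := \1_(`]0, +oo[%classic : set R))); exact: measurable_indic.
    have mH : measurable_fun setT (fun z : R * R => a * z.1 - z.2).
      apply: measurable_funB; last exact: measurable_snd.
      by apply: measurable_funM => //; exact: measurable_fst.
    have mI : measurable_fun setT (\1_(`]0, +oo[%classic : set R) : R -> R) by exact: measurable_indic.
    exact: (measurableT_comp mI mH).
have -> : (\int[mu]_(t in `]0%R, d]) ((t `^ c)%:E * \int[mu]_(u in `]0%R, (a * t)%R[) `|g u|%:E) =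
    \int[mu]_t \int[mu]_u Phi (t, u))%E.
  rewrite integral_mkcond; apply: eq_integral => t _; rewrite patchE.
  case: ifPn => [|td]; last first.
    rewrite integral0_eq // => u _; rewrite /Phi /J /= indicE (negbTE td).
    by rewrite mul0r mulr0.
  rewrite inE /= in_itv /= => /andP[t0 td].
  rewrite -ge0_integralZl //=; last 2 first.
  - by apply: measurable_funTS; apply/measurable_EFinP; exact: measurableT_comp.
  - by rewrite lee_fin powR_ge0.
  rewrite integral_mkcond; apply: eq_integral => u _.
  rewrite patchE /Phi /J /= !indicE !mem_setE !in_itv /= t0 td !andbT mul1r subr_gt0.
  by case: ltP => _; case: ltP => _; rewrite /= ?mulr1 ?mulr0 ?mul0r ?EFinM.
rewrite fubini_tonelli //=.
rewrite -ge0_integralZl //=; last 2 first.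
- apply: measurable_funTS; apply/measurable_EFinP; apply: measurableT_comp => //.
  by apply: measurable_funM => //; exact: measurable_powR.
- by rewrite lee_fin divr_ge0 ?powR_ge0 // ltW.
rewrite [leRHS]integral_mkcond; apply: ge0_le_integral => //=.
- by move=> u _; apply: integral_ge0.
- by apply: (@measurable_fun_fubini_tonelli_G _ _ _ _ R mu Phi).
- apply/(measurable_restrictT _ _).1; first exact: measurable_itv.
  apply: measurable_funTS; apply: measurable_funeM; apply/measurable_EFinP; apply: measurableT_comp => //.
  by apply: measurable_funM => //; exact: measurable_powR.
(* For [u] outside []0, a d[] no [t <= d] satisfies [0 < u < a t]. *)
move=> u _; rewrite patchE; case: ifPn => [|ud]; last first.
  rewrite integral0_eq // => t _; rewrite /Phi /J /= !indicE !mem_setE !in_itv /= !andbT subr_gt0.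
  move: ud; rewrite mem_setE in_itv /= negb_and -!leNgt.
  case: (ltP 0 t) => t0; case: (leP t d) => td; rewrite /= ?mul0r ?mulr0 ?mul1r //.
  case: (ltP 0 u) => u0; case: (ltP u (a * t)) => uat; rewrite /= ?mul0r ?mulr0 //.
  move=> adu; have h : a * t <= a * d := ler_wpM2l (ltW a0) td.
  by have := lt_le_trans uat (le_trans h adu); rewrite ltxx.
rewrite inE /= in_itv /= => /andP[u0 uad].
have ua0 : 0 < u / a by rewrite divr_gt0.
apply: (@le_trans _ _ (`|g u|%:E * \int[mu]_(t in `](u / a)%R, +oo[) (t `^ c)%:E)%E).
  rewrite -ge0_integralZl //=; last 2 first.
  - by apply: measurable_funTS; exact: measurable_powR_EFin.
  - by move=> t _; rewrite lee_fin powR_ge0.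
  rewrite [leRHS]integral_mkcond; apply: ge0_le_integral => //=.
  - have mJ : measurable_fun setT (J^~ u : R -> R).
      have mi (A : set R) : measurable A -> measurable_fun setT (\1_A : R -> R).
        by move=> mA; exact: measurable_indic.
      have ma : measurable_fun setT (fun t : R => a * t - u).
        by apply: measurable_funB => //; exact: measurable_funM.
      apply: measurable_funM; first exact: mi.
      by apply: measurable_funM => //; exact: (measurableT_comp (mi _ mpos) ma).
    have mp : measurable_fun setT (fun t : R => t `^ c * `|g u|).
      by apply: measurable_funM => //; exact: measurable_powR.
    by apply/measurable_EFinP; exact: (measurable_funM mp mJ).
  - apply/(measurable_restrictT _ _).1; first exact: measurable_itv.
    by apply: measurable_funTS; apply: measurable_funeM; exact: measurable_powR_EFin.
  - move=> t _; rewrite patchE mem_setE in_itv /= andbT ltr_pdivrMr // [t * a]mulrC.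
    rewrite /Phi /J /= !indicE !mem_setE !in_itv /= !andbT subr_gt0 u0 mul1r.
    case: (ltP u (a * t)) => uat; last by rewrite !mulr0.
    rewrite mulr1 -EFinM lee_fin [_ * `|g u|]mulrC.
    by rewrite ler_piMr ?mulr_ge0 ?powR_ge0 //; case: (_ && _).
apply: le_trans.
  apply: lee_wpmul2l; first by rewrite lee_fin.
  exact: integral_powR_tail_le ua0 c1.
have -> : (u / a) `^ (c + 1) = u `^ (c + 1) * a `^ (- (c + 1)).
  rewrite powRM ?invr_ge0 ?ltW //; congr (_ * _).
  by rewrite -(powR_inv1 (ltW a0)) -powRrM mulN1r.
rewrite -!EFinM lee_fin normrM (ger0_norm (powR_ge0 _ _)).
rewrite le_eqVlt; apply/orP; left; apply/eqP; lra.
Qed.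

Lemma measurable_integral_itv (g : R -> R) (a : R) : measurable_fun setT g ->
  measurable_fun setT (fun t : R => (\int[mu]_(u in `]0%R, (a * t)%R[) `|g u|%:E)%E).
Proof.
move=> mg.
pose Phi (z : R * R) : \bar R := (`|g z.2| *
  (\1_(`]0, +oo[%classic : set R) z.2 * \1_(`]0, +oo[%classic : set R) (a * z.1 - z.2)))%:E.
have Phi0 z : (0 <= Phi z)%E by rewrite lee_fin !mulr_ge0.
have mI : measurable_fun setT (\1_(`]0, +oo[%classic : set R) : R -> R) by exact: measurable_indic.
have mPhi : measurable_fun setT Phi.
  apply/measurable_EFinP; apply: measurable_funM.
    by apply: (measurable_comp_snd (F := fun u => `|g u|)); exact: measurableT_comp.
  apply: measurable_funM; first exact: (measurable_comp_snd mI).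
  have mH : measurable_fun setT (fun z : R * R => a * z.1 - z.2).
    apply: measurable_funB; last exact: measurable_snd.
    by apply: measurable_funM => //; exact: measurable_fst.
  exact: (measurableT_comp mI mH).
have -> : (fun t : R => (\int[mu]_(u in `]0%R, (a * t)%R[) `|g u|%:E)%E) =
    (fun t : R => (\int[mu]_u Phi (t, u))%E).
  apply/funext => t; rewrite integral_mkcond; apply: eq_integral => u _.
  rewrite patchE /Phi /= !indicE !mem_setE !in_itv /= !andbT subr_gt0.
  by case: ltP => _; case: ltP => _; rewrite /= ?mulr1 ?mulr0 ?mul0r.
by apply: (@measurable_fun_fubini_tonelli_F _ _ _ _ R mu Phi).
Qed.

End Tonelli.

(** * Uniform smallness near [t = 0] when [k < r - 1] *)

Section SmallIncrements.
Context {R : realType}.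
Local Notation mu := (@lebesgue_measure R).
Variables (G : set R) (r n : nat) (k : R) (E : set (R -> R)).
Hypotheses (hG : G = `[0, +oo[%classic \/ G = [set: R]) (r0 : (0 < r)%N).
Implicit Types (f : R -> R) (x y t : R).

Definition marchaud_integrand f x t := fwd_diff n t f x / t `^ (1 + k).

Lemma measurable_marchaud_integrand f x : measurable_fun G f -> G x ->
  measurable_fun `](0 : R), +oo[ (marchaud_integrand f x).
Proof.
move=> mf Gx.
have -> : marchaud_integrand f x = fun t => fwd_diff n t f x * t `^ (- (1 + k)).
  by apply/funext => t; rewrite /marchaud_integrand powRN.
apply: measurable_funM; last by apply: measurable_funTS; exact: measurable_powR.
apply: measurable_sum => m; apply: measurable_funM => //.
apply: (@measurable_comp _ _ _ _ _ _ G f) => //; first exact: measurable_dom.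
  move=> y [t tpos <-]; have t0 : 0 < t by move: tpos; rewrite /= in_itv /= andbT.
  by apply: (dom_up hG Gx); rewrite lerDl mulr_ge0 // ltW.
by apply: measurable_funD => //; exact: measurable_funM.
Qed.

Lemma marchaud_integrand_le f x t (B c : R) : 0 < t ->
  `|fwd_diff n t f x| <= B * t `^ c -> `|marchaud_integrand f x t| <= B * t `^ (c - 1 - k).
Proof.
move=> t0 H; rewrite /marchaud_integrand normrM [X in _ * X]ger0_norm ?invr_ge0 ?powR_ge0 //.
have -> : c - 1 - k = c - (1 + k) by lra.
have tn : t != 0 by rewrite gt_eqF.
rewrite powRB ?tn ?implybT // mulrA.
by apply: ler_wpM2r => //; rewrite invr_ge0 powR_ge0.
Qed.

Lemma powR_small (p e : R) : 0 < p -> 0 < e ->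
  exists b, [/\ 0 < b, b <= 1 & b `^ p <= e].
Proof.
move=> p0 e0; near (0 : R)^'+ => b; exists b; split => //.
- by near: b; apply: nbhs_right_le.
- rewrite -[b `^ p](ger0_norm (powR_ge0 _ _)) -[b `^ p]subr0 distrC; apply: ltW; near: b.
  have /cvgrPdist_lt := powR_cvg0 p0; exact.
Unshelve. all: by end_near. Qed.

(** [q] of the [n] differences become derivatives by the mean value theorem, the other [n - q]
    double the bound. As [x] and [t] are at most 1, all points involved lie in [[0, 1 + n]], where
    [f^(q)] has a bound independent of [x]. *)
Lemma fwd_diff_le_smooth f (q : nat) : Lr_space G r E f -> (q <= r.-1)%N -> (q <= n)%N ->
  exists2 M : R, 0 <= M & forall x t, 0 <= x -> x <= 1 -> 0 < t -> t <= 1 ->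
    `|fwd_diff n t f x| <= M * t ^+ q.
Proof.
move=> Lf qr qn.
have n1 : 0 <= 1 + n%:R :> R by rewrite addr_ge0.
have [M HM] := Lr_bounded hG Lf qr (dom0 hG) n1.
have M0 : 0 <= M.
  have h0 : 0 <= (0 : R) <= 1 + n%:R by rewrite lexx.
  exact: le_trans (normr_ge0 _) (HM 0 h0).
exists (2 ^+ (n - q) * M); first by rewrite mulr_ge0 // exprn_ge0.
move=> x t x0 x1 t0 t1; rewrite -[n in fwd_diff n](subnKC qn) -mulrA.
apply: fwd_diff_le_add => i id.
have Gy : G (x + i%:R * t) by apply: dom_nneg => //; rewrite addr_ge0 // mulr_ge0 // ltW.
have [|c /andP[yc cq] ->] := fwd_diff_MVT hG (F := fun j => deriven_on G j f) (q := q) _ Gy t0.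
  by move=> j jq; apply: (Lr_hasder Lf); exact: leq_trans jq qr.
rewrite normrM normrX normrN (gtr0_norm t0) mulrC.
apply: ler_wpM2r; first by rewrite exprn_ge0 // ltW.
apply: HM; apply/andP; split.
  by apply: le_trans yc; rewrite addr_ge0 // mulr_ge0 // ltW.
apply: le_trans cq _; rewrite -addrA; apply: lerD => //.
rewrite -mulrDl -natrD; apply: (@le_trans _ _ ((i + q)%:R * 1)).
  by apply: ler_wpM2l.
by rewrite mulr1 ler_nat addnC -leq_subRL.
Qed.

Definition uniformly_small f := forall e : R, 0 < e -> exists2 d : R, 0 < d &
  forall x, 0 <= x -> x <= 1 ->
    (\int[mu]_(t in `]0%R, d]) `|marchaud_integrand f x t|%:E <= e%:E)%E.

Lemma uniformly_small_smooth f (q : nat) : Lr_space G r E f -> (q <= r.-1)%N ->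
  (q <= n)%N -> k < q%:R -> uniformly_small f.
Proof.
move=> Lf qr qn kq e e0; have [M M0 HM] := fwd_diff_le_smooth Lf qr qn.
pose c := q%:R - 1 - k; have c1 : -1 < c by rewrite /c; lra.
have cp : 0 < c + 1 by lra.
(* [M] may be 0; [M + 1] can be divided by. *)
have M1 : 0 < M + 1 by lra.
have e'0 : 0 < e / ((M + 1) / (c + 1)) by rewrite divr_gt0 // divr_gt0.
have [b [b0 b1 be]] := powR_small cp e'0.
have be' : M * (b `^ (c + 1) / (c + 1)) <= e.
  move: be; rewrite ler_pdivlMr ?divr_gt0 //; apply: le_trans.
  rewrite mulrCA ler_wpM2l ?powR_ge0 // ler_pM2r ?invr_gt0 //; lra.
(* The power integral is bounded over the open []0, b[]; [b / 2] puts the closed end inside it. *)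
exists (b / 2); first by rewrite divr_gt0.
move=> x x0 x1.
have mh : measurable_fun `](0 : R), (b / 2)] (marchaud_integrand f x).
  apply: measurable_funS (measurable_marchaud_integrand _ _); first exact: measurable_itv.
  - by move=> t /=; rewrite !in_itv /= => /andP[->].
  - by case: Lf.
  - exact: dom_nneg.
apply: (@le_trans _ _ (\int[mu]_(t in `]0%R, (b / 2)%R]) (M%:E * (t `^ c)%:E))%E).
  apply: ge0_le_integral => //=.
  - by apply/measurable_EFinP; exact: measurableT_comp.
  - by apply: measurable_funTS; apply: measurable_funeM; exact: measurable_powR_EFin.
  - move=> t; rewrite in_itv /= => /andP[t0 tb]; rewrite -EFinM lee_fin.
    apply: marchaud_integrand_le => //; rewrite powR_mulrn; last exact: ltW.
    by apply: HM => //; apply: le_trans tb _; lra.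
apply: (@le_trans _ _ (\int[mu]_(t in `]0%R, b[) (M%:E * (t `^ c)%:E))%E).
  apply: ge0_subset_integral => //=.
  - by apply: measurable_funTS; apply: measurable_funeM; exact: measurable_powR_EFin.
  - by move=> t _; rewrite -EFinM lee_fin mulr_ge0 // powR_ge0.
  - by move=> t /=; rewrite !in_itv /= => /andP[h1 h]; apply/andP; split; lra.
rewrite ge0_integralZl //=; last 2 first.
- by apply: measurable_funTS; exact: measurable_powR_EFin.
- by move=> t _; rewrite lee_fin powR_ge0.
apply: le_trans.
  apply: lee_wpmul2l; first by rewrite lee_fin.
  exact: integral_powR_near0_le b0 c1.
by rewrite -EFinM lee_fin.
Qed.

End SmallIncrements.

(** * The integral near [t = 0] when [r - 1 < k] *)

Section SingularIncrements.
Context {R : realType}.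
Local Notation mu := (@lebesgue_measure R).
Variables (G : set R) (r n : nat) (k : R) (E : set (R -> R)) (N : (R -> R) -> R).
Hypotheses (hG : G = `[0, +oo[%classic \/ G = [set: R]) (r0 : (0 < r)%N).
Hypothesis hE : ideal_lattice G E N.
Hypotheses (hk0 : 0 < k) (hkn : k < n%:R).
Implicit Types (f : R -> R) (x y t : R).

Lemma derive_on_derive1 (F : R -> R) x y : G x -> x < y -> derivable F y 1 ->
  derive_on G F y = derive1 F y.
Proof.
move=> Gx xy dF; have Gy : G y := dom_up hG Gx (ltW xy).
have P := within_dom_proper hG Gy.
apply: cvg_lim => //; apply/cvgrPdist_lt => e e0; rewrite !near_withinE.
have cF : (fun h => h^-1 *: ((F \o shift y) (h *: 1) - F y)) @ 0^' --> derive1 F y.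
  by rewrite derive1E; exact: dF.
move/cvgrPdist_lt : cF => /(_ e e0); rewrite near_withinE => H0.
have : \forall h \near (0 : R), h != 0 ->
    `|derive1 F y - h^-1 *: (F (h *: 1 + y) - F y)| < e by exact: H0.
rewrite (near_shift y) /= sub0r; apply: filterS => z h zy _.
have := h; rewrite /= subr_eq0 => /(_ zy).
by rewrite /GRing.scale /= mulr1 subrK.
Qed.

Lemma Lr_increment_le f x y : Lr_space G r E f -> G x -> x <= y ->
  (`|deriven_on G r.-1 f y - deriven_on G r.-1 f x|%:E <=
     \int[mu]_(u in `]x, y[) `|deriven_on G r f u|%:E)%E.
Proof.
move=> Lf Gx xy; have [_ _ _ af Ef] := Lf.
apply: abs_continuous_le_integral => //.
- by apply: af; exact: dom_itv.
- apply: measurable_funS (il_measurable hE Ef); first exact: measurable_dom.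
  by move=> z /=; rewrite in_itv /= => /andP[xz _]; exact: dom_up Gx (ltW xz).
- move=> z xz zy dF; rewrite -[r in LHS](prednK r0) /deriven_on iterS.
  exact: derive_on_derive1 Gx xz dF.
Qed.

Lemma measurable_abs_deriven f (D : set R) : Lr_space G r E f -> measurable D -> D `<=` G ->
  measurable_fun D (fun u => `|deriven_on G r f u|%:E).
Proof.
move=> Lf mD DG; have [_ _ _ _ Ef] := Lf.
apply/measurable_EFinP; apply: measurableT_comp => //.
by apply: measurable_funS DG (il_measurable hE Ef); exact: measurable_dom.
Qed.

(** Of the [n] differences, [n - r] double the bound, [r - 1] become derivatives, and the last is an
    increment of [f^(r-1)] over some [[c, c + t]], bounded by the integral of [|f^(r)|] over a part
    of []0, n t[]. *)
Lemma fwd_diff_le_integral f t : Lr_space G r E f -> (r <= n)%N -> 0 < t ->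
  (`|fwd_diff n t f 0|%:E <= (2 ^+ (n - r) * t ^+ r.-1)%:E *
     \int[mu]_(u in `]0%R, (n%:R * t)%R[) `|deriven_on G r f u|%:E)%E.
Proof.
move=> Lf rn t0; have Gt : G t by apply: dom_nneg => //; exact: ltW.
set I := (\int[mu]_(u in _) _)%E.
have posG : `](0 : R), (n%:R * t)[%classic `<=` G.
  by move=> z /=; rewrite in_itv /= => /andP[z0 _]; apply: dom_nneg => //; exact: ltW.
have I0 : (0 <= I)%E by exact: integral_ge0.
have step i : (i <= n - r)%N -> (`|fwd_diff r t f (0 + i%:R * t)|%:E <= (t ^+ r.-1)%:E * I)%E.
  move=> ir; have Gy : G (0 + i%:R * t) by apply: dom_nneg => //; rewrite add0r mulr_ge0 // ltW.
  rewrite -[r in fwd_diff r](prednK r0) fwd_diffSr.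
  pose F j := deriven_on G j f \- fun z => deriven_on G j f (z + t).
  have hF j : (j < r.-1)%N -> hasder G (F j) (F j.+1).
    move=> jr; apply: hasderB => //; first exact: Lr_hasder Lf jr.
    by apply: hasder_shift => //; exact: Lr_hasder Lf jr.
  have [c /andP[yc cq] ->] := fwd_diff_MVT hG hF Gy t0.
  rewrite normrM normrX normrN (gtr0_norm t0) EFinM.
  apply: lee_wpmul2l; first by rewrite lee_fin exprn_ge0 // ltW.
  rewrite /F /= distrC; have Gc := dom_up hG Gy yc.
  apply: (le_trans (Lr_increment_le Lf Gc (_ : c <= c + t))); first by rewrite lerDl ltW.
  apply: ge0_subset_integral => //=.
  - exact: measurable_abs_deriven.
  - move=> z; rewrite /= !in_itv /= => /andP[cz zc]; apply/andP; split.
      by apply: le_lt_trans cz; apply: le_trans yc; rewrite add0r mulr_ge0 // ltW.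
    apply: lt_le_trans zc _; apply: (@le_trans _ _ ((i + r.-1 + 1)%:R * t)).
      by rewrite !natrD; lra.
    rewrite ler_pM2r // ler_nat -addnA addn1 (prednK r0) addnC -leq_subRL //.
(* [fwd_diff_le_add] needs a real bound; an infinite integral makes the claim trivial. *)
have [Iy|If] := eqVneq I +oo%E.
  by rewrite Iy gt0_muley ?leey // lte_fin mulr_gt0 // exprn_gt0.
have fI : I \is a fin_num by rewrite ge0_fin_numE // lt_neqAle If leey.
rewrite -(fineK fI) -EFinM lee_fin -mulrA -[n in fwd_diff n](subnKC rn).
apply: fwd_diff_le_add => i /step.
by rewrite -(fineK fI) -EFinM lee_fin.
Qed.

(** [integral_powR_iterated_le] with [a = n] and exponent [c = r - 2 - k] leaves a single integral
    against [x ^ (r - 1 - k)] on []0, n d[], that is, against [pow_indic] with [h = n d]; duality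
    bounds it. *)
Lemma marchaud_integrand_integral_le f (d A : R) : Lr_space G r E f ->
  (r <= n)%N -> r.-1%:R < k -> 0 < d ->
  (assoc_norm G E N (pow_indic r k (n%:R * d)) <= A%:E)%E ->
  (\int[mu]_(t in `]0%R, d]) `|marchaud_integrand n k f 0 t|%:E <=
   (2 ^+ (n - r) * (n%:R `^ (k - r.-1%:R) / (k - r.-1%:R)) * A * N (deriven_on G r f))%:E)%E.
Proof.
move=> Lf rn rk d0 hA; have [mf _ _ _ Ef] := Lf.
have n0 : 0 < n%:R :> R by exact: lt_trans hk0 hkn.
pose c := r.-1%:R - 1 - k; have c1 : c < -1 by rewrite /c; lra.
have cE : - (c + 1) = k - r.-1%:R by rewrite /c; lra.
have rE : r.-1%:R = r%:R - 1 :> R by rewrite -[r in RHS](prednK r0) -natr1; lra.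
(* Extended by 0 to be measurable on the whole line, as the iterated integral requires. *)
pose g := deriven_on G r f; pose gG := g \_ G.
have mg : measurable_fun setT gG.
  by apply/(measurable_restrictT _ _).1; [exact: measurable_dom|exact: (il_measurable hE Ef)].
have gGE u : 0 < u -> gG u = g u.
  by move=> u0; rewrite /gG patchE mem_set //; apply: dom_nneg => //; exact: ltW.
have m0d (f' : R -> R) : measurable_fun setT f' -> measurable_fun (`]0, d]%classic : set R) f'.
  by move=> mf'; exact: measurable_funTS.
have mI : measurable_fun setT (fun t : R => (\int[mu]_(u in `]0%R, (n%:R * t)%R[) `|gG u|%:E)%E).
  exact: measurable_integral_itv.
have mT : measurable_fun setT (fun t : R => ((t `^ c)%:E *
    \int[mu]_(u in `]0%R, (n%:R * t)%R[) `|gG u|%:E)%E).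
  by apply: emeasurable_funM => //; exact: measurable_powR_EFin.
have T0 t : (0 <= (t `^ c)%:E * \int[mu]_(u in `]0%R, (n%:R * t)%R[) `|gG u|%:E)%E.
  by apply: mule_ge0; [rewrite lee_fin powR_ge0|exact: integral_ge0].
apply: (@le_trans _ _ (\int[mu]_(t in `]0%R, d])
   ((2 ^+ (n - r))%:E * ((t `^ c)%:E * \int[mu]_(u in `]0%R, (n%:R * t)%R[) `|gG u|%:E)))%E).
  apply: ge0_le_integral => //=.
  - apply/measurable_EFinP; apply: measurableT_comp => //.
    apply: measurable_funS (measurable_marchaud_integrand n k hG mf (dom0 hG)); first exact: measurable_itv.
    by move=> t /=; rewrite !in_itv /= andbT => /andP[].
  - by apply: measurable_funTS; exact: measurable_funeM.
  - move=> t; rewrite in_itv /= => /andP[t0 td].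
    have tn : t != 0 by rewrite gt_eqF.
    rewrite /marchaud_integrand normrM [X in _ * X]ger0_norm ?invr_ge0 ?powR_ge0 //.
    rewrite mulrC EFinM.
    have -> : c = r.-1%:R - (1 + k) by rewrite /c; lra.
    rewrite powRB ?tn ?implybT // powR_mulrn; last exact: ltW.
    rewrite [_ / _]mulrC EFinM.
    rewrite !muleA [X in (_ <= X * _)%E](_ : _ = (t `^ (1 + k))^-1%:E * (2 ^+ (n - r) * t ^+ r.-1)%:E)%E; last first.
      by rewrite -!EFinM; congr EFin; lra.
    rewrite -muleA; apply: lee_wpmul2l; first by rewrite lee_fin invr_ge0 powR_ge0.
    apply: le_trans (fwd_diff_le_integral Lf rn t0) _; apply: lee_wpmul2l.
      by rewrite lee_fin mulr_ge0 // exprn_ge0 // ltW.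
    rewrite le_eqVlt; apply/orP; left; apply/eqP; apply: eq_integral => u.
    by rewrite inE /= in_itv /= => /andP[u0 _]; rewrite gGE.
rewrite ge0_integralZl //=; last exact: measurable_funTS.
set C := n%:R `^ _ / _; have C0 : 0 <= C by rewrite divr_ge0 ?powR_ge0 // subr_ge0 ltW.
have CE : C = n%:R `^ (k - r.-1%:R) / (k - r.-1%:R) by [].
clearbody C.
apply: (@le_trans _ _ ((2 ^+ (n - r))%:E * (C%:E *
    \int[mu]_(x in G) `|g x * pow_indic r k (n%:R * d) x|%:E))%E).
  apply: lee_wpmul2l; first by rewrite lee_fin.
  apply: le_trans (integral_powR_iterated_le mg n0 c1 d0) _; rewrite cE -CE.
  apply: lee_wpmul2l; first by rewrite lee_fin.
  have mp : measurable_fun setT (pow_indic r k (n%:R * d)).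
    by apply: measurable_funM; [exact: measurable_powR|exact: measurable_indic].
  apply: (@le_trans _ _ (\int[mu]_(x in `]0%R, (n%:R * d)%R[) `|g x * pow_indic r k (n%:R * d) x|%:E)%E).
    rewrite le_eqVlt; apply/orP; left; apply/eqP; apply: eq_integral => u.
    rewrite inE /= => uI; have u0 : 0 < u by move: uI; rewrite in_itv /= => /andP[].
    by rewrite gGE // /pow_indic indicE mem_set // mulr1 /c rE; congr (`|_ * _ `^ _|%:E); lra.
  apply: ge0_subset_integral => //=.
  - exact: measurable_dom.
  - apply/measurable_EFinP; apply: measurableT_comp => //; apply: measurable_funM.
      exact: (il_measurable hE Ef).
    exact: measurable_funTS.
  - by move=> u /=; rewrite in_itv /= => /andP[u0 _]; apply: dom_nneg => //; exact: ltW.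
rewrite -!mulrA 2!EFinM; do 2 (apply: lee_wpmul2l; first by rewrite lee_fin).
have mpG : measurable_fun G (pow_indic r k (n%:R * d)).
  apply: measurable_funTS; apply: measurable_funM; first exact: measurable_powR.
  exact: measurable_indic.
apply: le_trans (abs_integral_le_assoc (measurable_dom hG) hE Ef mpG) _.
by rewrite EFinM; apply: lee_wpmul2r => //; rewrite lee_fin (il_norm_ge0 hE).
Qed.

End SingularIncrements.

(** * Passage to the limit at 0 *)

Section LowerBound.
Context {R : realType}.
Local Notation mu := (@lebesgue_measure R).
Variables (G : set R) (r n : nat) (k : R) (E : set (R -> R)) (N : (R -> R) -> R).
Hypotheses (hG : G = `[0, +oo[%classic \/ G = [set: R]) (r0 : (0 < r)%N).
Hypotheses (hE : ideal_lattice G E N) (hs : semi_shift_invariant G E N).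
Hypotheses (hk0 : 0 < k) (hkn : k < n%:R).
Hypothesis hkN : k \isn't a Num.nat.
Hypothesis hlim : assoc_norm G E N (pow_indic r k h) @[h --> 0^'+] --> 0%E.
Implicit Types (f : R -> R) (x y t : R).

Lemma assoc_norm_pow_indic_small (e : R) : 0 < e ->
  exists2 h : R, 0 < h & (assoc_norm G E N (pow_indic r k h) <= e%:E)%E.
Proof.
move=> e0; have /fine_cvgP[fin /cvgrPdist_lt/(_ e e0) cv] := hlim.
near (0 : R)^'+ => h; exists h => //.
have hf : assoc_norm G E N (pow_indic r k h) \is a fin_num by near: h.
rewrite -(fineK hf) lee_fin; apply/ltW/(le_lt_trans (ler_norm _)).
by rewrite -[fine _]subr0 distrC; near: h.
Unshelve. all: by end_near. Qed.

Lemma marchaud_integrand_shift f x t :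
  marchaud_integrand n k (fun z => f (z + x)) 0 t = marchaud_integrand n k f x t.
Proof. by rewrite /marchaud_integrand fwd_diff_shift add0r. Qed.

(** Translation reduces [x] to 0 without increasing the norm of the r-th derivative, so one [d]
    serves all [x]. It is [h / n], because the differences reach up to [n d]. *)
Lemma uniformly_small_singular f : Lr_space G r E f -> (r <= n)%N -> r.-1%:R < k ->
  uniformly_small n k f.
Proof.
move=> Lf rn rk e e0.
have n0 : 0 < n%:R :> R by exact: lt_trans hk0 hkn.
pose C := 2 ^+ (n - r) * (n%:R `^ (k - r.-1%:R) / (k - r.-1%:R)).
have C0 : 0 <= C by rewrite mulr_ge0 ?exprn_ge0 // divr_ge0 ?powR_ge0 // subr_ge0 ltW.
have Nf0 : 0 <= N (deriven_on G r f) by apply: (il_norm_ge0 hE); case: Lf.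
pose M := C * N (deriven_on G r f) + 1.
have M0 : 0 < M by rewrite ltr_wpDl // mulr_ge0.
have [h h0 hA] := assoc_norm_pow_indic_small (divr_gt0 e0 M0).
exists (h / n%:R); first by rewrite divr_gt0.
move=> x x0 x1; have Gx : G x by exact: dom_nneg.
have Ls := Lr_shift hG hE hs r0 Lf Gx.
have [_ Ns] := Lr_deriven_shift_E hG hE hs r0 Lf Gx.
under eq_integral do rewrite -marchaud_integrand_shift.
apply: le_trans.
  apply: (marchaud_integrand_integral_le (N := N) (A := e / M) hG r0 hE hk0 hkn Ls rn rk).
    by rewrite divr_gt0.
  by rewrite mulrC divfK ?gt_eqF.
rewrite lee_fin -/C; apply: (@le_trans _ _ (C * (e / M) * N (deriven_on G r f))).
  by rewrite ler_wpM2l // mulr_ge0 // divr_ge0 // ltW.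
rewrite mulrAC; apply: (@le_trans _ _ (M * (e / M))).
  by apply: ler_wpM2r; [rewrite divr_ge0 // ltW|rewrite /M lerDl].
by rewrite mulrC divfK ?gt_eqF.
Qed.

(** [r - 1 = k] is excluded as [k] is not a natural number. If [r - 1 < k], then [k < n] gives the
    [r <= n] of the singular estimate. *)
Lemma Lr_uniformly_small f : Lr_space G r E f -> uniformly_small n k f.
Proof.
move=> Lf; have [rk|rk|rk] := ltgtP r.-1%:R k.
- apply: uniformly_small_singular => //.
  have : r.-1%:R < n%:R :> R by exact: lt_trans hkn.
  by rewrite ltr_nat prednK.
- apply: (uniformly_small_smooth (q := minn n r.-1) hG Lf).
  + exact: geq_minr.
  + exact: geq_minl.
  + by rewrite /minn; case: ifP.
- by move/negP : hkN; rewrite -rk; case; exact: natr_nat.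
Qed.

(** The majorant is [2 ^ n] times the norm of [f] times [t ^ (-1 - k)]. Since [u j > 0],
    right-continuity of [f] suffices for pointwise convergence of the integrands. *)
Lemma marchaud_cvg0 f (u : nat -> R) : Lr_space G r E f ->
  (forall j, 0 < u j) -> (forall j, u j <= 1) -> u j @[j --> \oo] --> 0 ->
  marchaud k n f (u j) @[j --> \oo] --> marchaud k n f 0.
Proof.
move=> Lf u0 u1 ucv; have [mf _ _ _ _] := Lf.
have Gu j : G (u j) by apply: dom_nneg => //; exact: ltW.
apply: cvgMr.
have dom x t : G x -> 0 < t ->
    `|marchaud_integrand n k f x t| <= 2 ^+ n * fine (Linf_norm G f) * t `^ (0 - 1 - k).
  move=> Gx t0; apply: marchaud_integrand_le => //; rewrite powRr0 mulr1.
  apply: fwd_diff_le => i _; apply: Lr_le_Linf Lf _ => //.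
  by apply: (dom_up hG Gx); rewrite lerDl mulr_ge0 // ltW.
apply: (@Rintegral_cvg_uniform_near0 _ (fun j => marchaud_integrand n k f (u j))
  (marchaud_integrand n k f 0) (2 ^+ n * fine (Linf_norm G f)) (0 - 1 - k)).
- by rewrite sub0r gtrDl oppr_lt0.
- by move=> j; exact: (measurable_marchaud_integrand n k hG mf (Gu j)).
- exact: (measurable_marchaud_integrand n k hG mf (dom0 hG)).
- move=> e e0; have [d d0 Hd] := Lr_uniformly_small Lf e0; exists d => //.
  by split => [j|]; apply: Hd => //; exact: ltW.
- by move=> j t t0; exact: dom.
- by move=> t t0; apply: dom => //; exact: dom0.
move=> t t0; apply: cvgMl; rewrite /fwd_diff.
apply: (cvg_big (op := +%R)) => [|m _]; [exact: add_continuous|apply: cvgMr].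
have Gt : G (m%:R * t) by apply: dom_nneg => //; rewrite mulr_ge0 // ltW.
have /cvg_at_rightP := Lr_right_continuous hG Lf Gt; rewrite add0r; apply; split.
  by move=> j; rewrite ltrDr.
rewrite -[X in _ --> X]add0r; apply: cvgD => //; exact: cvg_cst.
Qed.

(** The essential bound holds at points arbitrarily close to 0 from the right; [marchaud_cvg0] is
    applied along a sequence of them. *)
Lemma marchaud0_le_Linf f (M : R) : Lr_space G r E f ->
  (Linf_norm G (marchaud k n f) <= M%:E)%E -> marchaud k n f 0 <= M.
Proof.
move=> Lf LM.
have H j : exists x : R, 0 < x < j.+1%:R^-1 /\ marchaud k n f x <= M.
  have j0 : 0 < j.+1%:R^-1 :> R by rewrite invr_gt0.
  have [x xj Hx] := ae_dense (Linf_norm_ae G (marchaud k n f)) j0.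
  exists x; split => //; case/andP : xj => x0 _.
  have := le_trans (Hx (dom_nneg hG (ltW x0))) LM; rewrite lee_fin.
  exact: le_trans (ler_norm _).
have [u Hu] := choice H.
have u0 j : 0 < u j by have [/andP[]] := Hu j.
have u1 j : u j <= 1.
  have [/andP[_ /ltW h] _] := Hu j; apply: le_trans h _.
  by rewrite invf_le1 // ler1n.
have ucv : u j @[j --> \oo] --> 0.
  apply: (@squeeze_cvgr _ _ _ _ (cst 0) (@harmonic R)).
  - by apply: nearW => j; rewrite /= ltW //=; have [/andP[_ /ltW]] := Hu j.
  - exact: cvg_cst.
  - exact: cvg_harmonic.
have cv := marchaud_cvg0 Lf u0 u1 ucv.
rewrite -(cvg_lim _ cv) //; apply: limr_le; first by apply/cvg_ex; eexists; exact: cv.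
by apply: nearW => j; have [] := Hu j.
Qed.

End LowerBound.

(** * The remainder kernel does not vanish *)

Section Translation.
Context {R : realType}.
Local Notation mu := (@lebesgue_measure R).

Lemma lebesgue_measure_shift (a : R) (A : set R) : measurable A ->
  pushforward mu (fun x : R => (x + a : measurableTypeR R)) A = mu A.
Proof.
have mf : measurable_fun setT (fun x : R => (x + a : measurableTypeR R)).
  by apply: measurable_funD.
move=> mA; apply/esym/lebesgue_measure_unique => //= _ [[b c]] _ <-.
rewrite /pushforward (_ : _ @^-1` _ = `]b - a, c - a]%classic); last first.
  by apply/seteqP; split => x /=; rewrite !in_itv /= ltrBlDr lerBrDr.
rewrite !lebesgue_measure_itv /= !lte_fin ltrD2r; case: ifP => // _.
by rewrite -!EFinB; congr EFin; lra.
Qed.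

Lemma ae_shift (P : R -> Prop) (a : R) : {ae mu, forall x, P x} ->
  {ae mu, forall x, P (x + a)}.
Proof.
move=> [A [mA A0 PA]]; exists ((fun x : R => x + a) @^-1` A); split.
- rewrite -[X in measurable X]setTI; have mf : measurable_fun setT (fun x : R => x + a).
    by apply: measurable_funD.
  exact: mf.
- by have := lebesgue_measure_shift a mA; rewrite /pushforward => ->.
- by move=> x /= nP; exact: (PA (x + a)).
Qed.

Lemma ae_forall (P : nat -> R -> Prop) : (forall j, {ae mu, forall x, P j x}) ->
  {ae mu, forall x, forall j, P j x}.
Proof.
move=> H; have [A [mA A0 PA]] := negligible_bigcup H.
exists A; split => // x /= /existsNP[j nP].
by apply: (PA x); exists j.
Qed.

Lemma ae_and (P Q S : R -> Prop) : {ae mu, forall x, P x} ->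
  {ae mu, forall x, Q x} -> (forall x, P x -> Q x -> S x) -> {ae mu, forall x, S x}.
Proof.
move=> aP aQ PQS.
have H : forall j : nat, {ae mu, forall x, if j is 0%N then P x else Q x} by case.
by apply: ae_sub (ae_forall H) => x h; apply: PQS; [exact: (h 0%N)|exact: (h 1%N)].
Qed.

End Translation.

Section PolynomialDifferences.
Context {R : realType}.

(** Subtracting a translate cancels the leading coefficient and so lowers the degree. *)
Lemma fwd_diff_poly (q : nat) (p : {poly R}) (t x : R) : (size p <= q)%N ->
  fwd_diff q t (fun z => p.[z]) x = 0.
Proof.
elim: q p => [|q IH] p sp.
  by rewrite fwd_diff0; move: sp; rewrite leqn0 size_poly_eq0 => /eqP ->; rewrite horner0.
rewrite fwd_diffSr.
have -> : (fun z => p.[z]) \- (fun z => p.[z + t]) =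
    (fun z => (p - (p \Po ('X + t%:P))).[z]).
  by apply/funext => z; rewrite /= hornerD hornerN horner_comp hornerD hornerX hornerC.
apply: IH; have [->|p0] := eqVneq p 0; first by rewrite comp_poly0 subr0 size_poly0.
have s2 : size ('X + t%:P) = 2%N by rewrite size_XaddC.
have sc : size (p \Po ('X + t%:P)) = size p by apply: size_comp_poly2.
apply/leq_sizeP => j qj; rewrite coefB.
have [pj|jp] := leqP (size p) j; first by rewrite !nth_default ?sc // subrr.
have jE : j = (size p).-1.
  by have -> : size p = j.+1 by apply/eqP; rewrite eqn_leq jp (leq_trans sp).
have := @lead_coef_comp R p ('X + t%:P).
rewrite s2 => /(_ isT); rewrite lead_coefXaddC expr1n mulr1.
by rewrite /lead_coef sc -jE => ->; rewrite subrr.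
Qed.

Lemma fwd_diff_expr (q m : nat) (t x : R) : (m < q)%N ->
  fwd_diff q t (fun z => z ^+ m) x = 0.
Proof.
move=> mq; have -> : (fun z : R => z ^+ m) = (fun z => ('X^m : {poly R}).[z]).
  by apply/funext => z; rewrite hornerXn.
by apply: fwd_diff_poly; rewrite size_polyXn.
Qed.

End PolynomialDifferences.

Section KernelNonzero.
Context {R : realType}.
Local Notation mu := (@lebesgue_measure R).
Variables (G : set R) (E : set (R -> R)) (N : (R -> R) -> R).
Hypotheses (hG : G = `[0, +oo[%classic \/ G = [set: R]).
Hypotheses (hE : ideal_lattice G E N).

(** Every [f] in [E] has [f psi = 0] a.e., so it vanishes a.e. on the set [Z] where [psi] is
    nonzero. Then [E] still vanishes off [A] minus [Z], and minimality of the support [A] makes the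
    part of [Z] in [A] null; off [A], [psi] vanishes by membership in the associated space. *)
Lemma assoc_norm_eq0 psi : assoc_space G E N psi -> assoc_norm G E N psi = 0%E ->
  {ae mu, forall x, G x -> psi x = 0}.
Proof.
move=> [mpsi [A [mA AG Az Amin] psiA] _] n0.
have mG := measurable_dom hG.
pose Z := G `&` psi @^-1` (~` [set 0]).
have mZ : measurable Z by apply: mpsi => //; apply: measurableC; exact: measurable_set1.
have fZ f : E f -> {ae mu, forall x, G x -> f x * psi x = 0}.
  move=> Ef; have mf := il_measurable hE Ef.
  have : (\int[mu]_(x in G) `|f x * psi x|%:E = 0)%E.
    apply/eqP; rewrite eq_le integral_ge0 // andbT.
    by apply: le_trans (abs_integral_le_assoc mG hE Ef mpsi) _; rewrite n0 mul0e.
  move=> I0; have mfp : measurable_fun G (fun x => (f x * psi x)%:E).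
    by apply/measurable_EFinP; exact: measurable_funM.
  have [ae _] := @ae_eq_integral_abs _ _ R mu G mG (fun x => (f x * psi x)%:E) mfp.
  have := ae I0.
  by apply: ae_sub => x h Gx; have [] := h Gx.
have AZ : mu (A `\` (A `\` Z)) = 0%E.
  apply: Amin.
  - exact: measurableD.
  - by move=> x [/AG].
  - move=> f Ef; apply: (ae_and (Az f Ef) (fZ f Ef)) => x h1 h2 [Gx nAZ].
    have [Ax|nAx] := pselect (A x); last exact: h1.
    have [p0|p0] := pselect (psi x = 0).
      by exfalso; apply: nAZ; split => // -[].
    by have /eqP := h2 Gx; rewrite mulf_eq0 => /orP[/eqP//|/eqP].
have AZ0 : {ae mu, forall x, ~ (A `\` (A `\` Z)) x}.
  exists (A `\` (A `\` Z)); split => //.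
    by apply: measurableD => //; exact: measurableD.
  by move=> x /contrapT.
apply: (ae_and AZ0 psiA) => x h1 h2 Gx.
have [Ax|nAx] := pselect (A x); last exact: h2.
have [//|p0] := pselect (psi x = 0); exfalso; apply: h1; split => //.
by case=> _; apply; split.
Qed.

End KernelNonzero.

(** * Backward differences of the iterated primitive *)

Section IteratedPrimitive.
Context {R : realType}.
Local Notation mu := (@lebesgue_measure R).
Variables (G : set R) (Omega : R -> R).
Hypotheses (hG : G = `[0, +oo[%classic \/ G = [set: R]) (hOmega : BV_L1 G Omega).

Lemma trunc_pow_ge0 m (x : R) : 0 <= trunc_pow m x.
Proof. by rewrite /trunc_pow; case: ltP => // x0; rewrite exprn_ge0 // ltW. Qed.

Lemma trunc_pow_le m (x y : R) : x <= y -> trunc_pow m x <= trunc_pow m y.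
Proof.
move=> xy; rewrite {1}/trunc_pow; case: ltP => x0; last exact: trunc_pow_ge0.
by rewrite /trunc_pow (lt_le_trans x0 xy) lerXn2r // nnegrE ltW // (lt_le_trans x0 xy).
Qed.

Lemma measurable_trunc_pow m : measurable_fun setT (@trunc_pow R m).
Proof.
have -> : @trunc_pow R m = fun x => x ^+ m * \1_(`]0, +oo[%classic : set R) x.
  apply/funext => x; rewrite /trunc_pow indicE mem_setE in_itv /= andbT.
  by case: ltP; rewrite ?mulr1 ?mulr0.
apply: measurable_funM; first exact: exprn_measurable.
exact: measurable_indic.
Qed.

Lemma BV_bounded : exists2 M : R, 0 <= M & forall x, G x -> `|Omega x| <= M.
Proof.
have [_ tv] := hOmega.
have tv0 := TV_on_ge0 Omega (dom0 hG).
have tvf : TV_on G Omega \is a fin_num by rewrite ge0_fin_numE.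
exists (`|Omega 0| + fine (TV_on G Omega)); first by rewrite addr_ge0 // fine_ge0.
move=> x Gx; have H y z : G y -> G z -> y <= z -> `|Omega z - Omega y| <= fine (TV_on G Omega).
  move=> Gy Gz yz; rewrite -lee_fin fineK //.
  apply: le_trans (total_variation_ge _ yz) _.
  by apply: ereal_sup_ubound; exists (y, z).
have h : `|Omega x - Omega 0| <= fine (TV_on G Omega).
  have [x0|/ltW x0] := leP 0 x; first by apply: H => //; exact: dom0.
  by rewrite distrC; apply: H => //; exact: dom0.
by have := ler_distD 0 (Omega x) (Omega 0); have := lerB_dist (Omega x) (Omega 0); lra.
Qed.

Lemma measurable_Omega : measurable_fun G Omega.
Proof. by have [/integrableP[/measurable_EFinP]] := hOmega. Qed.

Let T m y s := trunc_pow m (y - s) * Omega s.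

Lemma measurable_trunc_pow_Omega m y : measurable_fun G (T m y).
Proof.
apply: measurable_funM; last exact: measurable_Omega.
apply: measurable_funTS; apply: measurableT_comp; first exact: measurable_trunc_pow.
exact: measurable_funB.
Qed.

Lemma integrable_trunc_pow_le m x y : y <= x ->
  mu.-integrable G (EFin \o T m x) -> mu.-integrable G (EFin \o T m y).
Proof.
move=> yx; apply: le_integrable; first exact: measurable_dom.
  by apply/measurable_EFinP; exact: measurable_trunc_pow_Omega.
move=> s Gs; rewrite /= lee_fin !normrM ler_wpM2r //.
by rewrite !ger0_norm ?trunc_pow_ge0 // trunc_pow_le // lerD2r.
Qed.

(** Backward differences evaluate the primitive only at points at most [x], where integrability is
    inherited from [x] because [trunc_pow] is nondecreasing; so the difference passes under the
    integral. *)
Lemma fwd_diff_iter_prim m q t x y : 0 < t -> y <= x ->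
  mu.-integrable G (EFin \o T m x) ->
  mu.-integrable G (EFin \o fun s => fwd_diff q (- t) (trunc_pow m) (y - s) * Omega s) /\
  fwd_diff q (- t) (iter_prim G m.+1 Omega) y =
    (m`!%:R)^-1 * \int[mu]_(s in G) (fwd_diff q (- t) (trunc_pow m) (y - s) * Omega s).
Proof.
move=> t0 + ix; elim: q y => [|q IH] y yx.
  have iy := integrable_trunc_pow_le yx ix.
  have E : (fun s => fwd_diff 0 (- t) (trunc_pow m) (y - s) * Omega s) = T m y.
    by apply/funext => s; rewrite fwd_diff0.
  by rewrite E fwd_diff0.
have ytx : y - t <= x by apply: le_trans yx; rewrite gerBl ltW.
have [i1 E1] := IH y yx; have [i2 E2] := IH (y - t) ytx.
have E : (fun s => fwd_diff q.+1 (- t) (trunc_pow m) (y - s) * Omega s) =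
  (fun s => fwd_diff q (- t) (trunc_pow m) (y - s) * Omega s) \-
  (fun s => fwd_diff q (- t) (trunc_pow m) (y - t - s) * Omega s).
  by apply/funext => s; rewrite fwd_diffS /= mulrBl addrAC.
rewrite E; split.
  have EB (F1 F2 : R -> R) : EFin \o (F1 \- F2) = ((EFin \o F1) \- (EFin \o F2))%E.
    by apply/funext.
  by rewrite EB; apply: integrableB => //; exact: measurable_dom.
rewrite fwd_diffS E1 E2 -mulrBr -RintegralB //; exact: measurable_dom.
Qed.

Lemma fwd_diff_eq q t (f g : R -> R) y :
  (forall i, (i <= q)%N -> f (y + i%:R * t) = g (y + i%:R * t)) ->
  fwd_diff q t f y = fwd_diff q t g y.
Proof. by move=> H; apply: eq_bigr => i _; rewrite H // -ltnS. Qed.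

(** Up to a factor this difference is a B-spline: left of 0 every term is 0, and right of
    [(m + 1) t] all nodes are positive, where the truncated power is a polynomial of degree [m],
    killed by a difference of order [m + 1]. *)
Lemma fwd_diff_trunc_pow_le m t (w : R) : 0 < t ->
  `|fwd_diff m.+1 (- t) (trunc_pow m) w| <=
  2 ^+ m.+1 * (m.+1%:R * t) ^+ m * \1_(`[0, (m.+1%:R * t)]%classic : set R) w.
Proof.
move=> t0; rewrite indicE mem_setE in_itv /=.
have [w0|w0] /= := leP 0 w; last first.
  rewrite mulr0 (fwd_diff_eq (g := fun z => 0 : R)).
    by rewrite /fwd_diff big1 ?normr0 // => i _; rewrite mulr0.
  move=> i _; rewrite /trunc_pow ltNge; case: (leP _ 0) => //; rewrite ltNge => /negP[].
  by apply: le_trans (ltW w0); rewrite gerDl mulrN oppr_le0 mulr_ge0 // ltW.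
have [wm|wm] /= := leP w (m.+1%:R * t); last first.
  rewrite mulr0 (fwd_diff_eq (g := fun z => z ^+ m)).
    by rewrite fwd_diff_expr // normr0.
  move=> i im; rewrite /trunc_pow ifT //.
  rewrite mulrN subr_gt0; apply: le_lt_trans wm.
  by rewrite ler_pM2r // ler_nat.
rewrite mulr1; apply: fwd_diff_le => i _.
rewrite ger0_norm ?trunc_pow_ge0 // /trunc_pow; case: ltP => h.
  apply: lerXn2r; rewrite ?nnegrE; [exact: ltW|by rewrite mulr_ge0 // ltW|].
  by apply: le_trans wm; rewrite gerDl mulrN oppr_le0 mulr_ge0 // ltW.
by rewrite exprn_ge0 // mulr_ge0 // ltW.
Qed.

(** The differenced kernel is of order [t ^ m] and lives on an interval of length [(m + 1) t], which
    supplies the further factor [t]. *)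
Lemma fwd_diff_iter_prim_le m t x (M : R) : 0 < t -> 0 <= M ->
  (forall s, G s -> `|Omega s| <= M) -> mu.-integrable G (EFin \o T m x) ->
  `|fwd_diff m.+1 (- t) (iter_prim G m.+1 Omega) x| <=
  (m`!%:R)^-1 * (2 ^+ m.+1 * m.+1%:R ^+ m.+1 * M) * t ^+ m.+1.
Proof.
move=> t0 M0 OM ix; have [iB ->] := fwd_diff_iter_prim m.+1 t0 (lexx x) ix.
have mt0 : 0 <= m.+1%:R * t by rewrite mulr_ge0 // ltW.
rewrite normrM ger0_norm ?invr_ge0 // -mulrA ler_wpM2l ?invr_ge0 //.
apply: abs_Rintegral_le; first exact: measurable_dom.
  by have [/measurable_EFinP] := integrableP _ _ _ iB.
pose c := 2 ^+ m.+1 * (m.+1%:R * t) ^+ m * M.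
have c0 : 0 <= c by rewrite mulr_ge0 // mulr_ge0 ?exprn_ge0.
pose I := (`[(x - m.+1%:R * t), x]%classic : set R).
have mI : measurable I by exact: measurable_itv.
apply: (@le_trans _ _ (\int[mu]_s (c * \1_I s)%:E)%E).
  apply: (@le_trans _ _ (\int[mu]_(s in G) (c * \1_I s)%:E)%E).
    apply: ge0_le_integral => //=.
    - exact: measurable_dom.
    - apply/measurable_EFinP; apply: measurableT_comp => //.
      by have [/measurable_EFinP] := integrableP _ _ _ iB.
    - by apply/measurable_EFinP; apply: measurable_funM => //; exact: measurable_indic.
    - move=> s Gs; rewrite lee_fin normrM.
      have -> : \1_I s = \1_(`[0, (m.+1%:R * t)]%classic : set R) (x - s) :> R.
        rewrite !indicE !mem_setE !in_itv /= subr_ge0 lerBlDr andbC.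
        by rewrite -lerBlDl.
      rewrite /c mulrAC; apply: ler_pM => //; last exact: OM.
      exact: fwd_diff_trunc_pow_le.
  apply: ge0_subset_integral => //=.
  - exact: measurable_dom.
  - by apply/measurable_EFinP; apply: measurable_funM => //; exact: measurable_indic.
  - by move=> s _; rewrite lee_fin mulr_ge0.
have -> : (\int[mu]_s (c * \1_I s)%:E = c%:E * mu I)%E.
  rewrite -integral_cst // [RHS]integral_mkcond; apply: eq_integral => s _.
  by rewrite patchE indicE; case: ifP => _; rewrite ?mulr1 ?mulr0.
rewrite lebesgue_measure_itv /= lte_fin.
case: ifP => _; last by rewrite mule0 lee_fin !mulr_ge0 ?exprn_ge0 // ltW.
rewrite -EFinB -EFinM lee_fin /c exprMn !exprSr.
rewrite le_eqVlt; apply/orP; left; apply/eqP; lra.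
Qed.

End IteratedPrimitive.

Section RemainderKernel.
Context {R : realType}.
Local Notation mu := (@lebesgue_measure R).

(** As [1 - s < 1], the number of shifts in [Gamma] is 0 and only Euler's integral remains. *)
Lemma Gamma_neq0 (s : R) : 0 < s -> Gamma s != 0.
Proof.
move=> s0; have t0 : Num.truncn (1 - s) = 0%N.
  rewrite truncn_floor; case: ifP => // h.
  have : (Num.truncn (1 - s) < 1)%N by rewrite truncn_lt_nat //; lra.
  by rewrite truncn_floor h ltnS leqn0 => /eqP.
by rewrite /Gamma t0 big_ord0 divr1 addr0 Gamma_int_neq0.
Qed.

Variables (G : set R) (r : nat) (k : R) (Omega : R -> R).
Hypotheses (hG : G = `[0, +oo[%classic \/ G = [set: R]) (r0 : (0 < r)%N).
Hypotheses (hk0 : 0 < k) (hkr : k < r%:R) (hOmega : BV_L1 G Omega).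

(* For almost every x in ]t/2, t[ the kernel vanishes at x and at all x - j t. As
   x - j t < 0 for j > 0, where R_{r-k} is 0, the (r-1)-st backward difference of
   Omega^[r-1] at x reduces to the value at x. *)
Lemma rem_ker_ae_zero_bound : {ae mu, forall x, G x -> rem_ker G r k Omega x = 0} ->
  exists2 C : R, 0 <= C & forall t, 0 < t ->
    exists2 x, t / 2 < x < t & `|Rker (r%:R - k) x| <= C * t ^+ r.-1.
Proof.
move=> ker0; have [M M0 OM] := BV_bounded hG hOmega.
have s0 : 0 < r%:R - k by rewrite subr_gt0.
have ker0' (t : R) : {ae mu, forall x, forall j : nat,
    G (x - j%:R * t) -> rem_ker G r k Omega (x - j%:R * t) = 0}.
  by apply: ae_forall => j; apply: (ae_shift _ ker0).
(* For [r = 1] the kernel contains [Omega] itself, bounded by [M], and no difference is taken. *)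
case rE : r.-1 => [|m].
  exists M => // t t0; have t2 : t / 2 < t by lra.
  have [x /andP[tx xt] Hx] := ae_dense ker0 t2.
  have Gx : G x by apply: dom_nneg => //; lra.
  exists x; first by rewrite tx.
  have := Hx Gx; rewrite /rem_ker rE /= => /eqP; rewrite subr_eq0 => /eqP ->.
  by rewrite mulr1; exact: OM.
exists ((m`!%:R)^-1 * (2 ^+ m.+1 * m.+1%:R ^+ m.+1 * M)).
  by rewrite mulr_ge0 ?invr_ge0 // mulr_ge0 // mulr_ge0 // exprn_ge0.
move=> t t0; have t2 : t / 2 < t by lra.
have [x /andP[tx xt] Hx] := ae_dense (ker0' t) t2.
have x0 : 0 < x by lra.
have Gx : G x by apply: dom_nneg => //; exact: ltW.
exists x; first by rewrite tx.
have Ex : Rker (r%:R - k) x = iter_prim G m.+1 Omega x.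
  have := Hx 0%N; rewrite mul0r subr0 => /(_ Gx); rewrite /rem_ker rE => /eqP.
  by rewrite subr_eq0 => /eqP.
have Ej j : (0 < j)%N -> iter_prim G m.+1 Omega (x - j%:R * t) = 0.
  move=> j0; have y0 : x - j%:R * t < 0.
    rewrite subr_lt0; apply: lt_le_trans xt _.
    by rewrite ler_peMl ?ler1n //; exact: ltW.
  have [Gy|nGy] := pselect (G (x - j%:R * t)).
    have := Hx j Gy; rewrite /rem_ker rE /Rker ltNge (ltW y0) /= sub0r => /eqP.
    by rewrite oppr_eq0 => /eqP.
  (* Here [x - j t] lies to the left of the half-line [G], so the truncated power vanishes for every
     [s] in [G]. *)
  rewrite /= /Rintegral integral0_eq ?mulr0 // => s Gs.
  rewrite /trunc_pow; case: ltP => // h; last by rewrite mul0r.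
  by exfalso; apply: nGy; apply: (dom_up hG Gs); rewrite -subr_ge0 ltW.
have xker0 : Rker (r%:R - k) x != 0.
  by rewrite /Rker x0 mulf_neq0 ?invr_neq0 ?Gamma_neq0 // gt_eqF // powR_gt0.
(* [Rintegral] is 0 if the integral is infinite, so a nonzero value gives
   integrability. *)
have ix : mu.-integrable G (EFin \o (fun s => trunc_pow m (x - s) * Omega s)).
  have mT := measurable_trunc_pow_Omega hOmega m x.
  apply/integrableP; split; first exact/measurable_EFinP.
  rewrite /= integral_fin_num_abs //; last exact: measurable_dom.
  move: xker0; rewrite Ex /= /Rintegral.
  by case: (integral _ _ _) => [z|/=|/=] //; rewrite mulr0 eqxx.
rewrite Ex; have <- : fwd_diff m.+1 (- t) (iter_prim G m.+1 Omega) x = iter_prim G m.+1 Omega x.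
  rewrite {1}/fwd_diff big_ord_recl big1 ?addr0 => [|i _].
    by rewrite expr0 bin0 !mul1r mul0r addr0.
  by rewrite mulrN Ej ?mulr0.
exact: (fwd_diff_iter_prim_le hG hOmega t0 M0 OM ix).
Qed.

Lemma rem_ker_not_ae_zero : ~ {ae mu, forall x, G x -> rem_ker G r k Omega x = 0}.
Proof.
move=> /rem_ker_ae_zero_bound[C C0 HC].
have s0 : 0 < r%:R - k by rewrite subr_gt0.
set m := r.-1 in HC; have rE : r%:R = m%:R + 1 :> R by rewrite -[r in LHS](prednK r0) -natr1.
(* The bound will reduce to [1 <= (D - 1) * t ^ k], which the choice [t ^ k <= 1 / (2 D)]
   contradicts. *)
pose D := C * `|Gamma (r%:R - k)| * 2 ^+ m + 1.
have D0 : 0 < D by rewrite ltr_wpDl // !mulr_ge0 // exprn_ge0.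
have e0 : 0 < (2 * D)^-1 by rewrite invr_gt0 mulr_gt0.
have [t [t0 _ tk]] := powR_small hk0 e0.
have [x /andP[tx xt] Hx] := HC t t0.
have x0 : 0 < x by lra.
have g0 : 0 < `|Gamma (r%:R - k)| by rewrite normr_gt0 Gamma_neq0.
have h1 : x `^ (m%:R - k) <= C * t ^+ m * `|Gamma (r%:R - k)|.
  move: Hx; rewrite /Rker x0 normrM normrV ?unitfE ?Gamma_neq0 //.
  rewrite ler_pdivrMr // ger0_norm ?powR_ge0 //.
  by rewrite (_ : r%:R - k - 1 = m%:R - k) // rE; lra.
have xn : x != 0 by rewrite gt_eqF.
(* [x ^ m] and [x ^ k] are bounded separately, from opposite ends of []t / 2, t[], since [m - k] may
   have either sign. *)
have h2 : (t / 2) ^+ m / t `^ k <= x `^ (m%:R - k).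
  rewrite powRB ?xn ?implybT // powR_mulrn; last exact: ltW.
  apply: ler_pM.
  - by rewrite exprn_ge0 // divr_ge0 // ltW.
  - by rewrite invr_ge0 powR_ge0.
  - by apply: lerXn2r; rewrite ?nnegrE ?divr_ge0 // ltW.
  - rewrite lef_pV2 ?posrE ?powR_gt0 //.
    by apply: ge0_ler_powR; rewrite ?nnegrE // ltW.
have tm : 0 < t ^+ m by rewrite exprn_gt0.
have tk0 : 0 < t `^ k by rewrite powR_gt0.
have h3 := le_trans h2 h1.
have : t ^+ m <= (D - 1) * t ^+ m * t `^ k.
  move: h3; rewrite ler_pdivrMr // expr_div_n ler_pdivrMr ?exprn_gt0 //.
  by move=> h; apply: le_trans h _; rewrite le_eqVlt; apply/orP; left; apply/eqP; rewrite /D; lra.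
rewrite -[X in X <= _]mulr1 [_ * t ^+ m]mulrC -mulrA ler_pM2l // => h4.
have : (D - 1) * t `^ k <= (D - 1) * (2 * D)^-1.
  by apply: ler_wpM2l => //; rewrite /D addrK !mulr_ge0 // exprn_ge0.
have : (D - 1) * (2 * D)^-1 < 1 by rewrite ltr_pdivrMr ?mulr_gt0 // mul1r; lra.
lra.
Qed.

End RemainderKernel.

Theorem theorem3 (R : realType) (G : set R) (r n : nat) (k : R)
    (E : set (R -> R)) (N : (R -> R) -> R) (Omega : R -> R)
    (hG : G = `[0, +oo[%classic \/ G = [set: R])
    (hk0 : 0 < k) (hkr : k < r%:R) (hkN : k \isn't a Num.nat)
    (hkn : k < n%:R)
    (hE : ideal_lattice G E N) (hEshift : semi_shift_invariant G E N)
    (hpow : assoc_space G E N (pow_indic r k 1))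
    (hlim : assoc_norm G E N (pow_indic r k h) @[h --> 0^'+] --> 0%E)
    (hOmega : BV_L1 G Omega)
    (hker : assoc_space G E N (rem_ker G r k Omega))
    (hrep : forall f, Lr_space G r E f ->
      marchaud k n f 0 - stieltjes G f Omega =
      (-1) ^+ r * \int[@lebesgue_measure R]_(x in G)
                     (rem_ker G r k Omega x * deriven_on G r f x)) :
  (forall f, Lr_space G r E f ->
    (Linf_norm G (marchaud k n f) <=
     TV_on G Omega * Linf_norm G f +
     assoc_norm G E N (rem_ker G r k Omega) * (N (deriven_on G r f))%:E)%E) /\
  (forall Phi, Wr_class G r E N Phi ->
    (stieltjes G Phi Omega)%:E = (TV_on G Omega * Linf_norm G Phi)%E ->
    ((-1) ^+ r * \int[@lebesgue_measure R]_(x in G)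
                    (rem_ker G r k Omega x * deriven_on G r Phi x))%:E =
      assoc_norm G E N (rem_ker G r k Omega) ->
    (forall C : R, (C%:E < assoc_norm G E N (rem_ker G r k Omega))%E ->
      ~ (forall f, Lr_space G r E f ->
          (Linf_norm G (marchaud k n f) <=
           TV_on G Omega * Linf_norm G f +
           C%:E * (N (deriven_on G r f))%:E)%E)) /\
    Linf_norm G (marchaud k n Phi) =
      (TV_on G Omega * Linf_norm G Phi +
       assoc_norm G E N (rem_ker G r k Omega) *
         (N (deriven_on G r Phi))%:E)%E).
Proof.
have r0 : (0 < r)%N by rewrite -(ltr_nat R); exact: lt_trans hkr.
have upper f : Lr_space G r E f -> (Linf_norm G (marchaud k n f) <=
    TV_on G Omega * Linf_norm G f +
    assoc_norm G E N (rem_ker G r k Omega) * (N (deriven_on G r f))%:E)%E.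
  exact: (Linf_marchaud_le hG r0 hE hEshift hOmega hker hrep).
split=> // Phi [LPhi NPhi1] stPhi remPhi.
have N0 : 0 <= N (deriven_on G r Phi) by apply: (il_norm_ge0 hE); case: LPhi.
have value := hrep _ LPhi.
have VE := TV_on_fineK hG hOmega.
have LE := Linf_norm_fineK LPhi.
have AE := assoc_norm_fineK hE hker.
have upperPhi := upper _ LPhi.
set V := fine (TV_on G Omega) in VE; set L := fine (Linf_norm G Phi) in LE.
set A := fine (assoc_norm G E N (rem_ker G r k Omega)) in AE.
have value0 : marchaud k n Phi 0 = V * L + A.
  move: stPhi remPhi; rewrite -VE -LE -AE -EFinM => -[stE] [remE].
  by move: value; rewrite stE remE => /eqP; rewrite subr_eq addrC => /eqP.
have lower M : (Linf_norm G (marchaud k n Phi) <= M%:E)%E -> V * L + A <= M.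
  move=> LM; rewrite -value0.
  exact: (marchaud0_le_Linf hG r0 hE hEshift hk0 hkn hkN hlim LPhi LM).
(* Excludes a negative C. *)
have A0 : 0 < A.
  have A_ge0 : 0 <= A by rewrite fine_ge0 // assoc_norm_ge0.
  rewrite lt_neqAle A_ge0 andbT; apply/negP => /eqP A_eq0.
  apply: (rem_ker_not_ae_zero hG r0 hk0 hkr hOmega).
  by apply: (assoc_norm_eq0 hG hE hker); rewrite -AE -A_eq0.
split=> [C CA H|].
  move: CA (H _ LPhi); rewrite -AE -VE -LE lte_fin -!EFinM -EFinD => CA /lower.
  rewrite lerD2l leNgt => /negP; apply.
  have [C0|/ltW C0] := leP 0 C.
    by apply: le_lt_trans CA; rewrite ler_piMr.
  by apply: le_lt_trans A0; rewrite mulr_le0_ge0.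
apply/eqP; rewrite eq_le upperPhi /=; move: upperPhi.
rewrite -AE -VE -LE -!EFinM -EFinD => upperPhi.
have fin : Linf_norm G (marchaud k n Phi) \is a fin_num.
  by rewrite ge0_fin_numE ?Linf_norm_ge0 // (le_lt_trans upperPhi) // ltry.
(* The norm of the r-th derivative of [Phi] is at most 1, so the right side is at most [V * L + A],
   the value of the Marchaud derivative at 0, which the essential norm dominates. *)
rewrite -(fineK fin) lee_fin; apply: (@le_trans _ _ (V * L + A)).
  by rewrite lerD2l ler_piMr // ltW.
by apply: lower; rewrite fineK.
Qed.
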